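(* For every action $S \curvearrowright L$ of an inverse semigroup $S$ on a locally finite weak semilattice $L$, the discretisation correspondence $\Omega \colon S \ltimes L^\times \to S \ltimes \widehat L$ induces an isomorphism in groupoid homology \[ \mathrm H_*(\Omega) \colon \mathrm H_*(S \ltimes L^\times) \xrightarrow{\sim} \mathrm H_*(S \ltimes \widehat{L}). \]
   Context: **Weak semilattices.** A weak semilattice is a poset $L$ with least element $0$ such that for all $k,l\in L$ there is a finite set $A$ of common lower bounds of $k,l$ such that each common lower bound is $\le$ some element of $A$; $k\downarrow l$ is the finite set of maximal common lower bounds. It is locally finite if each finite subset lies in a finite subset closed under $\downarrow$. $L^\times=L\setminus\{0\}$, a discrete space. $\widehat L$ is the space (pointwise convergence) of nonzero maps $\chi\colon L\to\{0,1\}$ with $\chi(0)=0$ such that $\chi(k)=\chi(l)=1$ iff $\chi(m)=1$ for some $m\in k\downarrow l$. $\widehat L(l)=\{\chi:\chi(l)=1\}$. **Actions.** Inverse semigroups have a $0$. Actions on spaces $X$ are by partial homeomorphisms $s\colon\mathrm{dom}_X(s)\to\mathrm{ran}_X(s)$ between open sets, compatible with products, $\mathrm{dom}_X(0)=\emptyset$, domains covering $X$. $S\ltimes X=\{(s,x):x\in\mathrm{dom}_X(s)\}/\!\sim$ with $(s,x)\sim(t,y)$ iff $x=y$ and there is $u\le s,t$ with $x\in\mathrm{dom}_X(u)$ ($\le$ the natural partial order); $[s,x]$ has source $x$, range $s.x$, $[t,s.x][s,x]=[ts,x]$; it is étale with unit space $X$, possibly non-Hausdorff. An action of $S$ on $L$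 is by order isomorphisms between down-sets, restricting to an action on the discrete space $L^\times$. It induces an action on $\widehat L$: $\mathrm{dom}_{\widehat L}(s)=\{\chi:\chi(l)=1\text{ for some }l\in\mathrm{dom}_L(s)\}$, $(s.\chi)(l)=1$ iff there is $k\in\mathrm{ran}_L(s)$, $k\le l$, $\chi(s^{-1}.k)=1$. **Homology.** For an ample groupoid $G$, $\mathrm H_*(G)$ is the homology of the complex $\mathbb Z[G^\bullet]$: $G^n$ is the space of composable $n$-tuples ($G^0$ the units), $\mathbb Z[Y]$ is the abelian group of functions $Y\to\mathbb Z$ spanned by indicator functions of compact open Hausdorff subsets, and the boundary maps are alternating sums of pushforwards along the face maps. **The discretisation correspondence and its map in homology.** Let $\Omega^0=\coprod_{l\in L^\times}\widehat L(l)=\{(l,\chi)\in L^\times\times\widehat L:\chi(l)=1\}$, with $S$-action $\mathrm{dom}_{\Omega^0}(s)=\coprod_{l\in\mathrm{dom}_{L^\times}(s)}\widehat L(l)$, $s.(l,\chi)=(s.l,s.\chi)$, and $S$-equivariant maps $\rho(l,\chi)=l$, $\sigma(l,\chi)=\chi$. The discretisation correspondence is $\Omega=\Omega^0\times_{\widehat L}(S\ltimes\widehat L)$ (pairs $(z,h)$ with $\sigma(z)=r(h)$), with left action $[s,l].(z,[t,\chi])=(s.z,[st,\chi])$ for $\rho(z)=l$ and right action by right multiplication. Put $G=S\ltimes L^\times$, $K=S\ltimes\Omega^0$, $H=S\ltimes\widehat L$. The map $\mathrm H_*(\Omega)$ is induced by the chain map $\mathbb Z[G^\bullet]\to\mathbb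 Z[H^\bullet]$ which in degree $n$ is the composite of pullback of functions along the proper map $K^n\to G^n$ induced by $\rho$ with pushforward along the local homeomorphism $K^n\to H^n$ induced by $\sigma$. *)

(* Defs.v *)
From HB Require Import structures.
From mathcomp Require Import all_boot all_order all_algebra.
From mathcomp Require Import all_classical all_reals all_analysis.
Set Implicit Arguments.
Unset Strict Implicit.
Unset Printing Implicit Defensive.
Import Order.TTheory GRing.Theory.
Local Open Scope classical_set_scope.
Local Open Scope ring_scope.
Local Open Scope quotient_scope.

HB.mixin Record Semigroup_isInverseSemigroup S of Semigroup S := {
  sinv : S -> S;
  szero : S;
  mulsVs : forall s : S, (s * sinv s * s)%g = s;
  mulVsV : forall s : S, (sinv s * s * sinv s)%g = sinv s;
  sinv_uniq : forall s t : S,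
    (s * t * s)%g = s -> (t * s * t)%g = t -> t = sinv s;
  mul0s : forall s : S, (szero * s)%g = szero;
  muls0 : forall s : S, (s * szero)%g = szero
}.

#[short(type="invSemigroupType")]
HB.structure Definition InverseSemigroup :=
  {S of Semigroup S & Semigroup_isInverseSemigroup S}.

Section InverseSemigroupTheory.
Variable S : invSemigroupType.
Local Open Scope group_scope.
Implicit Types s t u v e f : S.

Definition sidem e := e * e = e.

Definition natural_le s t := exists2 e, sidem e & s = t * e.

Lemma sidem_VM s : sidem (sinv s * s).
Proof. by rewrite /sidem mulgA mulVsV. Qed.

Lemma sidem_MV s : sidem (s * sinv s).
Proof. by rewrite /sidem mulgA mulsVs. Qed.

Lemma sidemM e f : sidem e -> sidem f -> sidem (e * f).
Proof.
rewrite /sidem => ee ff; set x := sinv (e * f).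
have eK a : a * e * e = a * e by rewrite -mulgA ee.
have fK a : a * f * f = a * f by rewrite -mulgA ff.
have h1 : e * f * x * e * f = e * f by rewrite -[RHS]mulsVs !mulgA.
have h2 a : a * x * e * f * x = a * x.
  have h : x * (e * f) * x = x by exact: mulVsV.
  by rewrite -[X in _ = a * X]h !mulgA.
have xE : f * x * e = x.
  by apply: sinv_uniq; rewrite !mulgA ?eK ?fK ?h1 ?h2.
have xx : x * x = x by rewrite -{1 2}xE !mulgA h2.
have Vx : x = sinv x by apply: sinv_uniq; rewrite !xx.
have -> : e * f = x; last exact: xx.
by rewrite [RHS]Vx; apply: sinv_uniq; rewrite ?mulsVs ?mulVsV.
Qed.

Lemma sidemC e f : sidem e -> sidem f -> e * f = f * e.
Proof.
move=> ee ff; have ef := sidemM ee ff; have fe := sidemM ff ee.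
rewrite /sidem in ee ff ef fe.
have eK a : a * e * e = a * e by rewrite -mulgA ee.
have fK a : a * f * f = a * f by rewrite -mulgA ff.
have -> : f * e = sinv (e * f).
  by apply: sinv_uniq; rewrite !mulgA ?eK ?fK ?eK ?fK -?(mulgA (_ * _)) ?ef ?fe.
by apply: sinv_uniq; rewrite !ef.
Qed.

Lemma natural_le_refl s : natural_le s s.
Proof. by exists (sinv s * s); [exact: sidem_VM | rewrite mulgA mulsVs]. Qed.

Lemma natural_le_trans t s u : natural_le s t -> natural_le t u -> natural_le s u.
Proof.
case=> e ee -> [f ff ->]; exists (f * e); rewrite ?mulgA//; exact: sidemM.
Qed.

Lemma natural_leM s s' t t' : natural_le s s' -> natural_le t t' -> natural_le (s * t) (s' * t').
Proof.
case=> e ee -> [f ff ->].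
have et : e * t' = t' * (sinv t' * e * t').
  by rewrite !mulgA (sidemC (sidem_MV t') ee) -mulgA -mulgA (mulgA t') mulsVs.
exists (sinv t' * e * t' * f).
  apply: sidemM => //; rewrite /sidem -[LHS]mulgA -et.
  by rewrite !mulgA -[_ * e * e]mulgA ee.
by rewrite !mulgA -(mulgA s') et !mulgA.
Qed.

End InverseSemigroupTheory.

(* A semigroup homomorphism from S to the partial bijections of X.  The
   function [papp a s] is only meaningful on [pdom a s].  Since [sinv] is then
   sent to the inverse partial bijection, the range of s is the domain of
   [sinv s]. *)
Record partial_action (S : invSemigroupType) (X : Type) := PartialAction {
  pdom : S -> set X;
  papp : S -> X -> X;
  pdomM : forall s t, pdom (s * t)%g = [set x | pdom t x /\ pdom s (papp t x)];
  pappM : forall s t x, pdom (s * t)%g x ->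
    papp (s * t)%g x = papp s (papp t x);
  papp_inj : forall s x y, pdom s x -> pdom s y ->
    papp s x = papp s y -> x = y
}.

Section PartialActionTheory.
Variables (S : invSemigroupType) (X : Type) (a : partial_action S X).
Implicit Types (s t u e : S) (x y : X).

Definition pran s := papp a s @` pdom a s.

Lemma papp_sidem e x : sidem e -> pdom a e x -> papp a e x = x.
Proof.
move=> ee ex; have eex : pdom a (e * e)%g x by rewrite ee.
have := pappM eex; rewrite ee => h.
by move: eex; rewrite pdomM => -[_ ?]; apply/esym; apply: papp_inj h.
Qed.

Lemma pdom_sinvM s : pdom a (sinv s * s)%g = pdom a s.
Proof.
apply/seteqP; split=> x; first by rewrite pdomM => -[].
by rewrite -{1}[s]mulsVs -mulgA (pdomM _ s) => -[].
Qed.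

Lemma pdom_sinv s x : pdom a s x -> pdom a (sinv s) (papp a s x).
Proof. by rewrite -pdom_sinvM pdomM => -[]. Qed.

Lemma pappK s x : pdom a s x -> papp a (sinv s) (papp a s x) = x.
Proof.
rewrite -pdom_sinvM => sx; rewrite -pappM//; apply: papp_sidem => //.
exact: sidem_VM.
Qed.

Lemma pdom_nle s t x : natural_le s t -> pdom a s x -> pdom a t x.
Proof. by case=> e ee ->; rewrite pdomM => -[/(papp_sidem ee) ->]. Qed.

Lemma papp_nle s t x : natural_le s t -> pdom a s x -> papp a s x = papp a t x.
Proof.
case=> e ee -> sx; rewrite pappM//.
by move: sx; rewrite pdomM => -[/(papp_sidem ee) ->].
Qed.

End PartialActionTheory.

Record action (S : invSemigroupType) (X : topologicalType) := Action {
  act :> partial_action S X;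
  open_pdom : forall s, open (pdom act s);
  continuous_papp : forall s x, pdom act s x ->
    {for x, continuous (papp act s)};
  pdom0 : pdom act (szero : S) = set0;
  pdom_cover : forall x, exists s, pdom act s x
}.

(* Algebraic groupoids with topologies on objects and arrows; [gmul g h] is
   only meaningful when [gsrc g = grng h]. *)
Record groupoid := Groupoid {
  gob : topologicalType;
  garr : topologicalType;
  gsrc : garr -> gob;
  grng : garr -> gob;
  gmul : garr -> garr -> garr;
  gone : gob -> garr;
  ginv : garr -> garr;
  gsrcM : forall g h, gsrc g = grng h -> gsrc (gmul g h) = gsrc h;
  grngM : forall g h, gsrc g = grng h -> grng (gmul g h) = grng g;
  gmulA : forall g h k, gsrc g = grng h -> gsrc h = grng k ->
    gmul g (gmul h k) = gmul (gmul g h) k;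
  gsrc1 : forall x, gsrc (gone x) = x;
  grng1 : forall x, grng (gone x) = x;
  gmul1g : forall g, gmul (gone (grng g)) g = g;
  gmulg1 : forall g, gmul g (gone (gsrc g)) = g;
  gsrcV : forall g, gsrc (ginv g) = grng g;
  grngV : forall g, grng (ginv g) = gsrc g;
  gmulVg : forall g, gmul (ginv g) g = gone (gsrc g);
  gmulgV : forall g, gmul g (ginv g) = gone (grng g)
}.

Section Germs.
Variables (S : invSemigroupType) (X : topologicalType) (a : action S X).
Implicit Types (s t u : S) (x y : X).

Definition germ_rep : topologicalType :=
  [set p : (discrete_topology S * X)%type | pdom a p.1 p.2].

Definition germ_rel (p q : germ_rep) : bool :=
  `[< (val p).2 = (val q).2 /\ exists u, [/\ natural_le u (val p).1,
        natural_le u (val q).1 & pdom a u (val p).2] >].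

Lemma germ_rel_equiv : equiv_class_of germ_rel.
Proof.
split.
- move=> p; apply/asboolP; split=> //; exists (val p).1.
  by split; [exact: natural_le_refl..|exact: (set_valP p)].
- have sym p q : germ_rel p q -> germ_rel q p.
    move=> /asboolP[e [u [up uq ux]]]; apply/asboolP; split=> //.
    by exists u; rewrite -e; split.
  by move=> p q; apply/idP/idP; exact: sym.
- move=> q p r /asboolP[e [u [up uq ux]]] /asboolP[e' [v [vq vr vx]]].
  apply/asboolP; split; first by rewrite e.
  case: vq => f ff vE; exists (u * f)%g; split.
  + by apply: natural_le_trans up; exists f.
  + apply: natural_le_trans vr; rewrite vE; case: uq => c cc ->.
    by exists c => //; rewrite -mulgA (sidemC cc ff) mulgA.
  + rewrite pdomM; move: vx; rewrite vE pdomM -e => -[fx _].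
    by split=> //; rewrite papp_sidem.
Qed.

Canonical germ_equiv := EquivRelPack germ_rel_equiv.

(* As S is discrete, the quotient topology has the sets of germs [s, U], for U
   an open subset of the domain of s, as a basis. *)
Definition germ_space : topologicalType :=
  quotient_topology {eq_quot germ_equiv}.

Definition germ s x (sx : pdom a s x) : germ_space :=
  \pi_germ_space (exist _ (s, x) (mem_set sx) : germ_rep).

Definition germ_src (g : germ_space) : X := (val (repr g)).2.
Definition germ_rng (g : germ_space) : X :=
  papp a (val (repr g)).1 (val (repr g)).2.

(* [t, s.x] [s, x] = [ts, x]; the default value is never used on composable
   pairs, see [germ_mulE] *)
Definition germ_mul (g h : germ_space) : germ_space :=
  \pi_germ_space (insubd (repr h)
    (((val (repr g)).1 * (val (repr h)).1)%g, (val (repr h)).2)).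

Lemma germW (P : germ_space -> Prop) :
  (forall s x (sx : pdom a s x), P (germ sx)) -> forall g, P g.
Proof.
move=> h g; rewrite -[g]reprK; case: (repr g) => -[s x] /= sx.
suff -> : \pi_germ_space (exist _ (s, x) sx : germ_rep) = germ (set_mem sx).
  exact: h.
by congr (\pi_germ_space _); exact: val_inj.
Qed.

Lemma germ_eqP s x (sx : pdom a s x) t y (ty : pdom a t y) :
  germ sx = germ ty <->
  x = y /\ exists u, [/\ natural_le u s, natural_le u t & pdom a u x].
Proof.
split=> [/eqmodP /asboolP //|h].
by apply/eqmodP/asboolP.
Qed.

Lemma repr_germ s x (sx : pdom a s x) :
  (val (repr (germ sx))).2 = x /\
  exists u, [/\ natural_le u (val (repr (germ sx))).1, natural_le u s & pdom a u x].
Proof.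
have : \pi_germ_space (repr (germ sx)) = germ sx by exact: reprK.
move=> /eqmodP /asboolP /= [e [u [us ut ux]]].
by split=> //; exists u; split=> //; rewrite -e.
Qed.

Lemma germ_srcE s x (sx : pdom a s x) : germ_src (germ sx) = x.
Proof. by have [] := repr_germ sx. Qed.

Lemma germ_rngE s x (sx : pdom a s x) : germ_rng (germ sx) = papp a s x.
Proof.
rewrite /germ_rng; have [-> [u [us ut ux]]] := repr_germ sx.
by rewrite -(papp_nle us)// (papp_nle ut).
Qed.

Lemma germ_mulE t y (ty : pdom a t y) s x (sx : pdom a s x)
    (tsx : pdom a (t * s)%g x) :
  y = papp a s x -> germ_mul (germ ty) (germ sx) = germ tsx.
Proof.
move=> ysx; rewrite /germ_mul.
have [yE [v [vt' vt vy]]] := repr_germ ty.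
have [xE [u [us' us ux]]] := repr_germ sx.
rewrite xE; set t' := (val _).1 in vt' *; set s' := (val _).1 in us' *.
have vux : pdom a (v * u)%g x.
  by rewrite pdomM; split=> //; rewrite (papp_nle us)// -ysx.
have tsx' : pdom a (t' * s')%g x by apply: pdom_nle vux; exact: natural_leM.
rewrite /insubd; case: insubP => [p _ pE|]; last first.
  by move=> /negP; elim; exact: mem_set.
apply/eqmodP/asboolP; rewrite pE /=; split=> //.
by exists (v * u)%g; split=> //; exact: natural_leM.
Qed.

Definition dom_of x : {s | pdom a s x} := cid (pdom_cover a x).

Lemma germ_one_subproof x : pdom a (sinv (sval (dom_of x)) * sval (dom_of x))%g x.
Proof. by rewrite pdom_sinvM; exact: svalP (dom_of x). Qed.

Definition germ_one x : germ_space := germ (germ_one_subproof x).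

Lemma germ_oneE e x (ex : pdom a e x) : sidem e -> germ ex = germ_one x.
Proof.
move=> ee; apply/germ_eqP; split=> //.
set f := (sinv _ * _)%g; have ff : sidem f by exact: sidem_VM.
exists (e * f)%g; split; first by exists f.
  by rewrite sidemC//; exists e.
have fx : pdom a f x by exact: germ_one_subproof.
by rewrite pdomM; split=> //; rewrite papp_sidem.
Qed.

Lemma germ_inv_subproof (g : germ_space) :
  pdom a (sinv (val (repr g)).1) (germ_rng g).
Proof. by apply: pdom_sinv; exact: (set_valP (repr g)). Qed.

Definition germ_inv (g : germ_space) : germ_space := germ (germ_inv_subproof g).

Lemma pdom_mul t s x : pdom a s x -> pdom a t (papp a s x) ->
  pdom a (t * s)%g x.
Proof. by rewrite pdomM. Qed.

Lemma germ_srcM g h : germ_src g = germ_rng h ->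
  germ_src (germ_mul g h) = germ_src h.
Proof.
elim/germW: g => t y ty; elim/germW: h => s x sx; rewrite germ_srcE germ_rngE.
move=> ysx; have tsx : pdom a (t * s)%g x by apply: pdom_mul; rewrite -?ysx.
by rewrite (germ_mulE ty sx tsx)// !germ_srcE.
Qed.

Lemma germ_rngM g h : germ_src g = germ_rng h ->
  germ_rng (germ_mul g h) = germ_rng g.
Proof.
elim/germW: g => t y ty; elim/germW: h => s x sx; rewrite germ_srcE germ_rngE.
move=> ysx; have tsx : pdom a (t * s)%g x by apply: pdom_mul; rewrite -?ysx.
by rewrite (germ_mulE ty sx tsx)// !germ_rngE pappM// ysx.
Qed.

Lemma germ_mulA g h k : germ_src g = germ_rng h -> germ_src h = germ_rng k ->
  germ_mul g (germ_mul h k) = germ_mul (germ_mul g h) k.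
Proof.
elim/germW: g => t y ty; elim/germW: h => s x sx; elim/germW: k => r z rz.
rewrite !germ_srcE !germ_rngE => yE xE.
have tsx : pdom a (t * s)%g x by apply: pdom_mul; rewrite -?yE.
have srz : pdom a (s * r)%g z by apply: pdom_mul; rewrite -?xE.
have tsrz : pdom a (t * (s * r))%g z.
  by apply: pdom_mul => //; rewrite pappM// -xE -yE.
have tsrz' : pdom a (t * s * r)%g z by rewrite -mulgA.
rewrite (germ_mulE sx rz srz)// (germ_mulE ty srz tsrz); last first.
  by rewrite pappM// -xE.
rewrite (germ_mulE ty sx tsx)// (germ_mulE tsx rz tsrz')//.
apply/germ_eqP; split=> //; exists (t * (s * r))%g; split=> //.
  exact: natural_le_refl.
by rewrite mulgA; exact: natural_le_refl.
Qed.

Lemma germ_src1 x : germ_src (germ_one x) = x.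
Proof. exact: germ_srcE. Qed.

Lemma germ_rng1 x : germ_rng (germ_one x) = x.
Proof. by rewrite germ_rngE papp_sidem//; [exact: sidem_VM|exact: germ_one_subproof]. Qed.

Lemma germ_mul1g g : germ_mul (germ_one (germ_rng g)) g = g.
Proof.
elim/germW: g => s x sx; rewrite germ_rngE.
have e : pdom a (s * sinv s)%g (papp a s x).
  by apply: pdom_mul; [exact: pdom_sinv|rewrite pappK].
rewrite -(germ_oneE e); last exact: sidem_MV.
have h : pdom a (s * sinv s * s)%g x by rewrite mulsVs.
rewrite (germ_mulE _ _ h)//; apply/germ_eqP; split=> //.
by exists s; rewrite mulsVs; split=> //; exact: natural_le_refl.
Qed.

Lemma germ_mulg1 g : germ_mul g (germ_one (germ_src g)) = g.
Proof.
elim/germW: g => s x sx; rewrite germ_srcE.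
have e : pdom a (sinv s * s)%g x by rewrite pdom_sinvM.
rewrite -(germ_oneE e); last exact: sidem_VM.
have h : pdom a (s * (sinv s * s))%g x by rewrite mulgA mulsVs.
rewrite (germ_mulE _ _ h)//; last by rewrite papp_sidem//; exact: sidem_VM.
apply/germ_eqP; split=> //.
by exists s; rewrite mulgA mulsVs; split=> //; exact: natural_le_refl.
Qed.

Lemma germ_reprE g : exists2 sx : pdom a (val (repr g)).1 (germ_src g),
  True & g = germ sx.
Proof.
have sx := set_valP (repr g); exists sx => //.
rewrite -[LHS]reprK /germ; congr (\pi_germ_space _); apply: val_inj => /=.
by rewrite /germ_src -surjective_pairing.
Qed.

Lemma germ_srcV g : germ_src (germ_inv g) = germ_rng g.
Proof. exact: germ_srcE. Qed.

Lemma germ_rngV g : germ_rng (germ_inv g) = germ_src g.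
Proof. by rewrite germ_rngE pappK//; exact: (set_valP (repr g)). Qed.

Lemma germ_mulVg g : germ_mul (germ_inv g) g = germ_one (germ_src g).
Proof.
have [sx _ gE] := germ_reprE g; rewrite {2}gE.
have h : pdom a (sinv (val (repr g)).1 * (val (repr g)).1)%g (germ_src g).
  by rewrite pdom_sinvM.
by rewrite (germ_mulE _ _ h)// (germ_oneE h)//; exact: sidem_VM.
Qed.

Lemma germ_mulgV g : germ_mul g (germ_inv g) = germ_one (germ_rng g).
Proof.
have [sx _ gE] := germ_reprE g; rewrite {1}gE.
have rE : papp a (sinv (val (repr g)).1) (germ_rng g) = germ_src g.
  by rewrite pappK.
have h : pdom a ((val (repr g)).1 * sinv (val (repr g)).1)%g (germ_rng g).
  by apply: pdom_mul; [exact: germ_inv_subproof|rewrite rE].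
by rewrite (germ_mulE _ _ h)// (germ_oneE h)//; exact: sidem_MV.
Qed.

Definition transformation_groupoid : groupoid := Groupoid germ_srcM germ_rngM germ_mulA
  germ_src1 germ_rng1 germ_mul1g germ_mulg1 germ_srcV germ_rngV germ_mulVg
  germ_mulgV.

End Germs.

Section Nerve.
Variable G : groupoid.

Definition composable n (g : 'I_n -> garr G) : Prop :=
  forall i j : 'I_n, j = i.+1 :> nat -> gsrc (g i) = grng (g j).

(* composable n-tuples, with the subspace topology of the product *)
Definition nerve (n : nat) : topologicalType :=
  if n is m.+1 then
    ([set g : {ptws 'I_m.+1 -> garr G} | composable g] : topologicalType)
  else gob G.

(* For g = (g_0, ..., g_n.+1), the i-th face drops g_0 if i = 0, drops g_n.+1
   if i = n.+2 and otherwise replaces g_(i-1), g_i by their product. *)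
Definition face_tuple n (i : 'I_n.+3) (g : 'I_n.+2 -> garr G) (j : 'I_n.+1) :
    garr G :=
  let g0 := g (widen_ord (leqnSn _) j) in
  let g1 := g (lift ord0 j) in
  if (j.+1 < i)%N then g0 else if j.+1 == i :> nat then gmul g0 g1 else g1.

Lemma face_tuple_composable n (i : 'I_n.+3) (g : 'I_n.+2 -> garr G) :
  composable g -> composable (face_tuple i g).
Proof.
move=> cg j k kj; rewrite /face_tuple kj.
have c l : gsrc (g (widen_ord (leqnSn _) l)) = grng (g (lift ord0 l)).
  by apply: cg => /=; rewrite /bump.
have e : lift ord0 j = widen_ord (leqnSn _) k.
  by apply: val_inj; rewrite /= kj /bump.
have [ji|ij|ji] := ltngtP j.+1 i.
- have [ki|ki|ki] := ltngtP j.+2 i.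
  + by rewrite -e; exact: c.
  + by move: (leq_trans ki ji); rewrite ltnn.
  + by rewrite grngM// -e; exact: c.
- have [ki|ki|ki] := ltngtP j.+2 i.
  + by move: (ltn_trans ki ij); rewrite ltnNge leqW.
  + by rewrite e; exact: c.
  + by move: ij; rewrite -ki ltnNge leqnSn.
- have -> : (j.+2 < i)%N = false by rewrite -ji ltnNge leqnSn.
  have -> : (j.+2 == i :> nat) = false by rewrite -ji gtn_eqF.
  by rewrite gsrcM// e; exact: c.
Qed.

Definition face n : 'I_n.+2 -> nerve n.+1 -> nerve n :=
  match n return 'I_n.+2 -> nerve n.+1 -> nerve n with
  | 0 => fun i g =>
      if i == ord0 then gsrc (val g ord0) else grng (val g ord0)
  | m.+1 => fun i g =>
      exist _ (face_tuple i (val g))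
        (mem_set (face_tuple_composable i (set_valP g)))
  end.

End Nerve.

Record groupoid_hom (G H : groupoid) := GroupoidHom {
  hob : gob G -> gob H;
  harr : garr G -> garr H;
  hsrc : forall g, gsrc (harr g) = hob (gsrc g);
  hrng : forall g, grng (harr g) = hob (grng g);
  hmul : forall g h, gsrc g = grng h ->
    harr (gmul g h) = gmul (harr g) (harr h)
}.

Lemma hom_composable (G H : groupoid) (f : groupoid_hom G H) n
  (g : 'I_n -> garr G) : composable g -> composable (harr f \o g).
Proof. by move=> cg i j ij /=; rewrite hsrc hrng (cg _ _ ij). Qed.

Definition nerve_map (G H : groupoid) (f : groupoid_hom G H) n :
    nerve G n -> nerve H n :=
  match n return nerve G n -> nerve H n with
  | 0 => hob f
  | m.+1 => fun g =>
      exist _ (harr f \o val g) (mem_set (hom_composable f (set_valP g)))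
  end.

Section CompactOpenFunctions.
Variable Y : topologicalType.

Definition compact_open_hausdorff (U : set Y) : Prop :=
  [/\ compact U, open U & hausdorff_space U].

Definition cohfun : pred (Y -> int) := fun f =>
  `[< exists (n : nat) (c : 'I_n -> int) (U : 'I_n -> set Y),
        (forall i, compact_open_hausdorff (U i)) /\
        f = \sum_(i < n) (fun y => c i * \1_(U i) y) >].

Lemma cohfun_zmod_closed : zmod_closed cohfun.
Proof.
split; first by apply/asboolP; exists 0, (fun _ => 0), (fun _ => set0);
  rewrite big_ord0; split=> // -[].
move=> f g /asboolP[n [c [U [hU ->]]]] /asboolP[m [d [V [hV ->]]]].
apply/asboolP; exists (n + m)%N.
exists (fun i : 'I_(n + m) => match fintype.split i with inl j => c j | inr k => - d k end).
exists (fun i : 'I_(n + m) => match fintype.split i with inl j => U j | inr k => V k end).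
split; first by move=> i; case: fintype.split.
rewrite big_split_ord/= -sumrN; congr (_ + _); apply: eq_bigr => i _.
  by rewrite -[lshift _ _]/(unsplit (inl i)) unsplitK.
rewrite -[rshift _ _]/(unsplit (inr i)) unsplitK.
by apply/funext => y; rewrite /= mulNr.
Qed.

HB.instance Definition _ := GRing.isZmodClosed.Build (Y -> int) cohfun
  cohfun_zmod_closed.

(* Z[Y] *)
Definition cohz := {f : Y -> int | f \in cohfun}.
HB.instance Definition _ := Choice.on cohz.
HB.instance Definition _ := SubType.on cohz.
HB.instance Definition _ := [SubChoice_isSubZmodule of cohz by <:].

End CompactOpenFunctions.

(* The additive map Z[Y] -> Z[Z] given on functions by F; it is uniquely
   determined when it exists, and 0 is a default value otherwise.  The default
   does not occur for pushforwards along local homeomorphisms of ample spaces,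
   such as the face maps below, nor for pullbacks along proper maps. *)
Definition cohz_map (Y Z : topologicalType) (F : (Y -> int) -> (Z -> int)) :
    {additive cohz Y -> cohz Z} :=
  if pselect (exists g : {additive cohz Y -> cohz Z},
                forall f, val (g f) = F (val f)) is left e
  then sval (cid e) else \0.

(* the sums over fibres have finite support in the cases of interest *)
Definition cohz_pushforward (Y Z : topologicalType) (p : Y -> Z) :=
  cohz_map (fun (f : Y -> int) z => \sum_(y \in p @^-1` [set z]) f y).

Definition cohz_pullback (Y Z : topologicalType) (p : Y -> Z) :=
  cohz_map (fun (f : Z -> int) => f \o p).

Section Homology.
Variable G : groupoid.

Definition chains n := cohz (nerve G n).
HB.instance Definition _ n := GRing.Zmodule.on (chains n).

Definition boundary n (f : chains n.+1) : chains n :=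
  \sum_(i < n.+2) (cohz_pushforward (@face G n i) f : chains n) *~ (-1) ^+ i.

Lemma boundary_is_zmod_morphism n : zmod_morphism (@boundary n).
Proof.
move=> f g; rewrite /boundary -sumrB; apply: eq_bigr => i _.
by rewrite raddfB/= mulrzBl.
Qed.

HB.instance Definition _ n := GRing.isZmodMorphism.Build _ _ (@boundary n)
  (@boundary_is_zmod_morphism n).

Definition is_cycle n : pred (chains n) :=
  match n return pred (chains n) with
  | 0 => predT
  | m.+1 => fun f => boundary f == 0
  end.

Lemma is_cycle_zmod_closed n : zmod_closed (@is_cycle n).
Proof.
case: n => [|n]; first by split.
split; rewrite /in_mem/= ?raddf0// => f g; rewrite /in_mem/=.
by move=> /eqP f0 /eqP g0; rewrite raddfB/= f0 g0 subr0.
Qed.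

HB.instance Definition _ n := GRing.isZmodClosed.Build _ (@is_cycle n)
  (@is_cycle_zmod_closed n).

Definition cycles n := {f : chains n | f \in @is_cycle n}.
HB.instance Definition _ n := Choice.on (cycles n).
HB.instance Definition _ n := SubType.on (cycles n).
HB.instance Definition _ n := [SubChoice_isSubZmodule of cycles n by <:].

Definition is_boundary n : {pred cycles n} :=
  fun f => `[< exists g, val f = boundary g >].

Lemma is_boundary_zmod_closed n : zmod_closed (@is_boundary n).
Proof.
split; first by apply/asboolP; exists 0; rewrite !raddf0.
move=> f g /asboolP[f' f'E] /asboolP[g' g'E]; apply/asboolP.
by exists (f' - g'); rewrite !raddfB/= f'E g'E.
Qed.

HB.instance Definition _ n := GRing.isZmodClosed.Build _ (@is_boundary n)
  (@is_boundary_zmod_closed n).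

Definition homology n : zmodType := Quotient.quot (@is_boundary n).

Definition homology_class n (f : cycles n) : homology n :=
  \pi_(Quotient.quot (@is_boundary n)) f.

End Homology.

(* phi is the map induced in homology by the chain map F in degree n; in
   particular, F maps cycles to cycles and boundaries to boundaries *)
Definition induced_in_homology (G H : groupoid) n (F : chains G n -> chains H n)
    (phi : homology G n -> homology H n) : Prop :=
  forall f : cycles G n, exists2 g : cycles H n,
    val g = F (val f) & phi (homology_class f) = homology_class g.

Record equivariant (S : invSemigroupType) (X Y : topologicalType)
    (a : action S X) (b : action S Y) := Equivariant {
  emap :> X -> Y;
  emap_dom : forall s x, pdom a s x -> pdom b s (emap x);
  emap_app : forall s x, pdom a s x -> emap (papp a s x) = papp b s (emap x)
}.

Section GermHom.
Variables (S : invSemigroupType) (X Y : topologicalType).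
Variables (a : action S X) (b : action S Y) (f : equivariant a b).

(* [s, x] |-> [s, f x] *)
Definition germ_map (g : germ_space a) : germ_space b :=
  germ (emap_dom f (set_valP (repr g))).

Lemma germ_mapE s x (sx : pdom a s x) (sfx : pdom b s (f x)) :
  germ_map (germ sx) = germ sfx.
Proof.
have [xE [u [us' us ux]]] := repr_germ sx.
apply/germ_eqP; rewrite xE; split=> //.
by exists u; split=> //; exact: emap_dom.
Qed.

Lemma germ_map_src g : germ_src (germ_map g) = f (germ_src g).
Proof. exact: germ_srcE. Qed.

Lemma germ_map_rng g : germ_rng (germ_map g) = f (germ_rng g).
Proof. by rewrite germ_rngE -emap_app//; exact: (set_valP (repr g)). Qed.

Lemma germ_mapM g h : germ_src g = germ_rng h ->
  germ_map (germ_mul g h) = germ_mul (germ_map g) (germ_map h).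
Proof.
elim/germW: g => t y ty; elim/germW: h => s x sx; rewrite germ_srcE germ_rngE.
move=> ysx; have tsx : pdom a (t * s)%g x by apply: pdom_mul; rewrite -?ysx.
have ftsx := emap_dom f tsx.
have fty := emap_dom f ty; have fsx := emap_dom f sx.
rewrite (germ_mulE ty sx tsx)// (germ_mapE tsx ftsx).
rewrite (germ_mapE ty fty) (germ_mapE sx fsx) (germ_mulE fty fsx ftsx)//.
by rewrite ysx emap_app.
Qed.

Definition germ_hom : groupoid_hom (transformation_groupoid a) (transformation_groupoid b) :=
  @GroupoidHom (transformation_groupoid a) (transformation_groupoid b) f germ_map
    germ_map_src germ_map_rng germ_mapM.

End GermHom.

HB.mixin Record BPOrder_isWeakSemilattice d L of Order.BPOrder d L := {
  weak_meet : forall k l : L, exists A : seq L,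
    (forall m, m \in A -> (m <= k)%O /\ (m <= l)%O) /\
    (forall m, (m <= k)%O -> (m <= l)%O -> exists2 a, a \in A & (m <= a)%O)
}.

#[short(type="weakSemilatticeType")]
HB.structure Definition WeakSemilattice d :=
  {L of Order.BPOrder d L & BPOrder_isWeakSemilattice d L}.

Section WeakSemilattice.
Context {d : Order.disp_t} {L : weakSemilatticeType d}.
Implicit Types k l m : L.

Definition meets k l : set L := [set m | [/\ (m <= k)%O, (m <= l)%O &
  forall n : L, (n <= k)%O -> (n <= l)%O -> (m <= n)%O -> n = m]].

Lemma meets_max k l m : (m <= k)%O -> (m <= l)%O ->
  exists2 n, meets k l n & (m <= n)%O.
Proof.
move=> mk ml; have [A [Akl Amax]] := weak_meet k l.
have [r rE] := ubnP (count (fun a => (m < a)%O) A).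
elim: r m mk ml rE => // r IHr m mk ml.
rewrite ltnS => rE.
have [h|/existsNP[n]] := pselect (forall n : L, (n <= k)%O -> (n <= l)%O ->
  (m <= n)%O -> n = m); first by exists m.
move=> /not_implyP[nk /not_implyP[nl /not_implyP[mn /eqP nm]]].
have {nm}mn : (m < n)%O by rewrite lt_neqAle eq_sym nm.
have [a aA na] := Amax _ nk nl; have ma := lt_le_trans mn na.
have [ak al] := Akl _ aA.
have [|b ? ab] := IHr a ak al; last by exists b => //; apply: le_trans ab; exact: ltW.
apply: leq_trans rE; have : (0 < count_mem a A)%N by rewrite -has_count has_pred1.
rewrite -(ltn_add2l (count (fun b => (a < b)%O) A)) addn0 => /leq_trans; apply.
rewrite -count_predUI [X in (_ + X)%N](_ : _ = 0%N); last first.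
  by apply/eqP; rewrite -leqn0 leqNgt -has_count; apply/hasPn => b _ /=;
     case: eqP => [->|]; rewrite ?ltxx ?andbF.
rewrite addn0; apply: sub_count => b /= /orP[/(lt_trans ma)//|/eqP->//].
Qed.

Definition locally_finite : Prop := forall F : set L, finite_set F ->
  exists F', [/\ finite_set F', F `<=` F' &
    forall k l, F' k -> F' l -> meets k l `<=` F'].

Definition nonzero : choiceType := {l : L | l != \bot%O}.
Definition nonzero_space : topologicalType := discrete_topology nonzero.

Definition is_character (chi : L -> bool) : Prop :=
  [/\ exists l, chi l, chi \bot%O = false &
    forall k l, chi k /\ chi l <-> exists2 m, meets k l m & chi m].

(* with the topology of pointwise convergence *)
Definition hat : topologicalType :=
  [set chi : {ptws L -> bool} | is_character chi].

Definition ev (chi : hat) : L -> bool := sval chi.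

Lemma meets_le k l : (k <= l)%O -> meets k l k.
Proof. by move=> kl; split=> // n nk _ kn; apply/le_anti; rewrite nk. Qed.

Lemma character_le (chi : hat) k l : (k <= l)%O -> ev chi k -> ev chi l.
Proof.
move=> kl ck; have [_ _ /(_ k l)[_ h]] := set_valP chi.
by have [] // := h _; exists k => //; exact: meets_le.
Qed.

End WeakSemilattice.

Arguments locally_finite {d} L.
Arguments nonzero {d} L.
Arguments nonzero_space {d} L.
Arguments hat {d} L.

(* An action by order isomorphisms between down-sets.  Since partial actions
   are semigroup homomorphisms, the last two conditions express that it
   restricts to an action on the discrete space of nonzero elements. *)
Record order_action (S : invSemigroupType) d (L : weakSemilatticeType d) :=
  OrderAction {
  oact :> partial_action S L;
  pdom_down : forall s k l, pdom oact s l -> (k <= l)%O -> pdom oact s k;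
  pran_down : forall s k l, pran oact s l -> (k <= l)%O -> pran oact s k;
  papp_mono : forall s k l, pdom oact s k -> pdom oact s l ->
    (papp oact s k <= papp oact s l)%O = (k <= l)%O;
  pdom_szero : forall l, pdom oact (szero : S) l -> l = \bot%O;
  pdom_nonzero : forall l, l != \bot%O -> exists s, pdom oact s l
}.

Section InducedActions.
Context {S : invSemigroupType} {d : Order.disp_t} {L : weakSemilatticeType d}.
Variable a : order_action S L.
Implicit Types (s t : S) (k l m : L).

Lemma papp_eq_bot s l : pdom a s l -> (papp a s l == \bot%O) = (l == \bot%O).
Proof.
move=> sl; have s0 := pdom_down sl (le0x l).
have [y sy yE] : pran a s \bot%O.
  by apply: pran_down (le0x (papp a s l)); exists l.
have s0E : papp a s \bot%O = \bot%O.
  by apply/le_anti; rewrite le0x andbT -[X in (_ <= X)%O]yE papp_mono// le0x.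
apply/eqP/eqP => [slE|->//]; apply: (papp_inj sl s0).
by rewrite s0E.
Qed.

Definition nz_dom s : set (nonzero_space L) := [set l | pdom a s (sval l)].
Definition nz_app s (l : nonzero_space L) : nonzero_space L :=
  insubd (l : nonzero L) (papp a s (sval l)).

Lemma nz_appE s (l : nonzero_space L) :
  nz_dom s l -> sval (nz_app s l) = papp a s (sval l).
Proof.
move=> sl; rewrite -[LHS]/(val (nz_app s l : nonzero L)) val_insubd papp_eq_bot//.
by have /= -> := valP (l : nonzero L).
Qed.

Lemma nz_domM s t :
  nz_dom (s * t)%g = [set l | nz_dom t l /\ nz_dom s (nz_app t l)].
Proof.
apply/seteqP; split=> l; rewrite /nz_dom/= pdomM.
  by move=> [tl stl]; split=> //; rewrite nz_appE.
by move=> [tl]; rewrite nz_appE.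
Qed.

Lemma nz_appM s t (l : nonzero_space L) : nz_dom (s * t)%g l -> nz_app (s * t)%g l = nz_app s (nz_app t l).
Proof.
move=> stl; apply: val_inj => /=; rewrite nz_appE//.
move: stl; rewrite nz_domM => -[tl sl]; rewrite nz_appE// nz_appE// pappM//.
by rewrite pdomM; split=> //; rewrite -nz_appE.
Qed.

Lemma nz_app_inj s (l k : nonzero_space L) : nz_dom s l -> nz_dom s k -> nz_app s l = nz_app s k ->
  l = k.
Proof.
move=> sl sk e; apply: val_inj; apply: (papp_inj sl sk).
by rewrite -!nz_appE// e.
Qed.

Lemma nz_dom0 : nz_dom (szero : S) = set0.
Proof.
apply/seteqP; split=> // l /pdom_szero l0.
by have := valP (l : nonzero L); rewrite /= l0 eqxx.
Qed.

Lemma nz_cover (l : nonzero_space L) : exists s, nz_dom s l.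
Proof. exact: pdom_nonzero (valP (l : nonzero L)). Qed.

Lemma nz_continuous s (l : nonzero_space L) : nz_dom s l -> {for l, continuous (nz_app s)}.
Proof.
move=> _ U; rewrite !nbhs_principalE.
by move=> /principal_filterP Ul; exact/principal_filterP.
Qed.

Definition nz_action : action S (nonzero_space L) :=
  @Action S (nonzero_space L) (PartialAction nz_domM nz_appM nz_app_inj)
    (fun s => discrete_open _) nz_continuous nz_dom0 nz_cover.

Definition hat_dom s : set (hat L) :=
  [set chi | exists2 l, pdom a s l & ev chi l].

Definition hat_fun s (chi : hat L) : {ptws L -> bool} := fun l =>
  `[< exists k, [/\ pran a s k, (k <= l)%O & ev chi (papp a (sinv s) k)] >].

Lemma hat_funP s (chi : hat L) l : hat_fun s chi l <->
  exists k, [/\ pdom a s k, (papp a s k <= l)%O & ev chi k].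
Proof.
split=> [/asboolP[_ [[k sk <-] kl]]|[k [sk kl ck]]].
  by rewrite pappK// => ck; exists k.
by apply/asboolP; exists (papp a s k); rewrite pappK//; split=> //; exists k.
Qed.

Lemma hat_fun_character s chi : hat_dom s chi -> is_character (hat_fun s chi).
Proof.
have [_ c0 cm] := set_valP chi.
move=> [l0 sl0 cl0]; split.
- by exists (papp a s l0); apply/hat_funP; exists l0.
- apply/negP => /hat_funP[k [sk]]; rewrite lex0 papp_eq_bot// => /eqP ->.
  by rewrite [ev _ _]c0.
- move=> k l; split; last first.
    move=> [m [mk ml _] /hat_funP[n [sn nm cn]]].
    by split; apply/hat_funP; exists n; split=> //; exact: le_trans nm _.
  move=> [/hat_funP[k' [sk' kk ck]] /hat_funP[l' [sl' ll cl]]].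
  have /cm[m [mk ml _] cmm] : ev chi k' /\ ev chi l' by [].
  have sm := pdom_down sk' mk.
  have [||n ? mn] := @meets_max _ _ k l (papp a s m).
  - by apply: le_trans kk; rewrite papp_mono.
  - by apply: le_trans ll; rewrite papp_mono.
  by exists n => //; apply/hat_funP; exists m.
Qed.

Definition hat_app s (chi : hat L) : hat L := insubd chi (hat_fun s chi).

Lemma hat_appE s chi : hat_dom s chi -> ev (hat_app s chi) = hat_fun s chi.
Proof.
move=> sc; rewrite -[LHS]/(val (hat_app s chi)) val_insubd mem_set//.
exact: hat_fun_character.
Qed.

Lemma hat_domM s t :
  hat_dom (s * t)%g = [set chi | hat_dom t chi /\ hat_dom s (hat_app t chi)].
Proof.
apply/seteqP; split=> chi.
  move=> [l]; rewrite pdomM => -[tl stl] cl.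
  have tc : hat_dom t chi by exists l.
  split=> //; exists (papp a t l) => //; rewrite hat_appE//.
  by apply/hat_funP; exists l.
move=> [tc [l sl]]; rewrite hat_appE// => /hat_funP[k [tk kl ck]].
by exists k => //; rewrite pdomM; split=> //; exact: pdom_down kl.
Qed.

Lemma hat_appM s t chi : hat_dom (s * t)%g chi ->
  hat_app (s * t)%g chi = hat_app s (hat_app t chi).
Proof.
move=> stc; apply: val_inj; rewrite [LHS]hat_appE//.
move: stc; rewrite hat_domM => -[tc sc]; rewrite [RHS]hat_appE//.
apply/funext => l; apply/idP/idP => /hat_funP.
  move=> [k [stk kl ck]]; apply/hat_funP; exists (papp a t k).
  rewrite -pappM// hat_appE//; move: stk; rewrite pdomM => -[tk stk].
  by split=> //; apply/hat_funP; exists k.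
move=> [k [sk kl]]; rewrite hat_appE// => /hat_funP[m [tm mk cm]].
have stm : pdom a s (papp a t m) by exact: pdom_down mk.
have h : pdom a (s * t)%g m by rewrite pdomM.
apply/hat_funP; exists m; split=> //; rewrite pappM//.
by apply: le_trans kl; rewrite papp_mono.
Qed.

Lemma hat_app_inj s chi psi : hat_dom s chi -> hat_dom s psi ->
  hat_app s chi = hat_app s psi -> chi = psi.
Proof.
wlog suff h : chi psi / hat_dom s chi -> hat_dom s psi ->
    hat_app s chi = hat_app s psi -> forall l, ev chi l -> ev psi l.
  move=> sc sp e; apply: val_inj; apply/funext => l.
  by apply/idP/idP; apply: h.
move=> sc sp e l cl; have [k sk ck] := sc.
have [_ _ /(_ k l)[h _]] := set_valP chi.
have [//|m [mk ml _] cm] := h; have sm := pdom_down sk mk.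
have : hat_fun s psi (papp a s m).
  by rewrite -hat_appE// -e hat_appE//; apply/hat_funP; exists m.
move=> /hat_funP[n [sn nm pn]]; apply: (@character_le _ _ psi n) => //.
by apply: le_trans ml; rewrite -(papp_mono sn sm).
Qed.

Lemma hat_dom0 : hat_dom (szero : S) = set0.
Proof.
apply/seteqP; split=> // chi [l /pdom_szero ->].
by have [_ c0 _] := set_valP chi; rewrite [ev _ _]c0.
Qed.

Lemma hat_cover chi : exists s, hat_dom s chi.
Proof.
have [[l cl] c0 _] := set_valP chi.
have [|s sl] := @pdom_nonzero _ _ _ a l; last by exists s, l.
by apply/eqP => l0; move: cl; rewrite l0 c0.
Qed.

Lemma eval_continuous l : continuous (fun chi : hat L => ev chi l).
Proof.
move=> chi; apply: (@continuous_comp (hat L) {ptws L -> bool} bool set_val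
  (fun f => f l)).
  exact: initial_continuous.
exact: (@proj_continuous L (fun _ => bool) l).
Qed.

Lemma near_eval (chi : hat L) l : \forall psi \near chi, ev psi l = ev chi l.
Proof. exact: (eval_continuous (discrete_set1 (ev chi l))). Qed.

Lemma open_hat_dom s : open (hat_dom s).
Proof.
rewrite openE => chi [l sl cl]; rewrite /interior.
apply: filterS (near_eval chi l) => psi pl.
by exists l => //; rewrite pl.
Qed.

Lemma continuous_hat (X : topologicalType) (f : X -> hat L) (x : X) :
  (forall l, \forall y \near x, ev (f y) l = ev (f x) l) ->
  {for x, continuous f}.
Proof.
move=> h U [/= V [[W oW WV] Vfx VU]].
have hcvg : (fun y => ev (f y) : {ptws L -> bool}) @ x -->
    (ev (f x) : {ptws L -> bool}).
  apply/cvg_sup => l A [/= B [[C oC CB] Bfx BA]].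
  apply: filterS (h l) => y yx; apply: BA; rewrite -CB /=.
  by rewrite yx; move: Bfx; rewrite -CB.
have : nbhs (ev (f x) : {ptws L -> bool}) W.
  by apply: open_nbhs_nbhs; split=> //; move: Vfx; rewrite -WV.
move=> /hcvg hW; have {}hW : \forall y \near x, W (ev (f y)) by exact: hW.
suff : \forall y \near x, U (f y) by [].
by apply: filterS hW => y Wy; apply: VU; rewrite -WV.
Qed.

Lemma hat_continuous s chi : hat_dom s chi -> {for chi, continuous (hat_app s)}.
Proof.
move=> sc; have [x0 sx0 cx0] := sc.
have ndom : \forall psi \near chi, hat_dom s psi.
  by apply: open_nbhs_nbhs; split=> //; exact: open_hat_dom.
apply: continuous_hat => l; rewrite hat_appE//.
have [/hat_funP[k [sk kl ck]]|nc] := boolP (hat_fun s chi l).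
  have hk : \forall psi \near chi, hat_dom s psi /\ ev psi k = ev chi k.
    by apply: filterI => //; exact: near_eval.
  apply: filterS hk => psi [sp pk].
  by rewrite hat_appE//; apply/hat_funP; exists k; rewrite pk.
have [A [Axl Amax]] := weak_meet (papp a s x0) l.
have hA : \forall psi \near chi, forall b, b \in A ->
    ev psi (papp a (sinv s) b) = ev chi (papp a (sinv s) b).
  elim: (A) => [|b B IH]; first by apply: filterS ndom => psi _ b; rewrite in_nil.
  apply: filterS (filterI (near_eval chi (papp a (sinv s) b)) IH) => psi [pb pB] c.
  by rewrite inE => /orP[/eqP->//|/pB].
apply: filterS (filterI ndom (filterI hA (near_eval chi x0))) => psi [sp [pA px0]].
rewrite hat_appE//; apply/negP => /hat_funP[y [sy yl py]].
have [_ _ /(_ y x0)[h _]] := set_valP psi.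
have [|m [my mx _] pm] := h; first by split=> //; rewrite [val _ _]px0.
have sm := pdom_down sy my.
have [||b bA mb] := Amax (papp a s m); first by rewrite papp_mono.
  by apply: le_trans yl; rewrite papp_mono.
have [bx bl] := Axl _ bA.
have [c sc' cb] : pran a s b by apply: pran_down bx; exists x0.
move/negP: nc; apply; apply/hat_funP; exists c; split=> //; first by rewrite cb.
have := pA _ bA; rewrite -cb pappK// => <-.
by apply: (@character_le _ _ psi m) => //; rewrite -(papp_mono sm sc') cb.
Qed.

Definition hat_action : action S (hat L) :=
  @Action S (hat L) (PartialAction hat_domM hat_appM hat_app_inj)
    open_hat_dom hat_continuous hat_dom0 hat_cover.

(* the coproduct over the nonzero l of the spaces of chi with chi l = 1 *)
Definition Omega0 : topologicalType :=
  [set z : (nonzero_space L * hat L)%type | ev z.2 (sval z.1)].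

Definition rho_fun (z : Omega0) : nonzero_space L := (set_val z).1.
Definition sigma_fun (z : Omega0) : hat L := (set_val z).2.

Definition Omega0_dom s : set Omega0 := [set z | nz_dom s (rho_fun z)].
Definition Omega0_app s (z : Omega0) : Omega0 :=
  insubd z (nz_app s (rho_fun z), hat_app s (sigma_fun z)).

Lemma ev_Omega0 z : ev (sigma_fun z) (sval (rho_fun z)).
Proof. exact: (set_valP z). Qed.

Lemma Omega0_dom_sigma s z : Omega0_dom s z -> hat_dom s (sigma_fun z).
Proof. by move=> sz; exists (sval (rho_fun z)); last exact: ev_Omega0. Qed.

Lemma Omega0_appE s z : Omega0_dom s z ->
  set_val (Omega0_app s z) = (nz_app s (rho_fun z), hat_app s (sigma_fun z)).
Proof.
move=> sz; rewrite /Omega0_app [LHS]val_insubd mem_set//=.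
rewrite hat_appE; last exact: Omega0_dom_sigma.
rewrite nz_appE//; apply/hat_funP; exists (sval (rho_fun z)).
by split=> //; exact: ev_Omega0.
Qed.

Lemma Omega0_domM s t : Omega0_dom (s * t)%g =
  [set z | Omega0_dom t z /\ Omega0_dom s (Omega0_app t z)].
Proof.
apply/seteqP; split=> z; rewrite /Omega0_dom/= nz_domM.
  by move=> [tz stz]; split=> //; rewrite /rho_fun Omega0_appE.
by move=> [tz]; rewrite {1}/rho_fun Omega0_appE.
Qed.

Lemma Omega0_appM s t z : Omega0_dom (s * t)%g z ->
  Omega0_app (s * t)%g z = Omega0_app s (Omega0_app t z).
Proof.
move=> stz; apply: val_inj; rewrite [LHS]Omega0_appE//.
have := stz; rewrite Omega0_domM => -[tz sz]; rewrite [RHS]Omega0_appE//.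
rewrite /rho_fun /sigma_fun Omega0_appE//= nz_appM// hat_appM//.
exact: Omega0_dom_sigma.
Qed.

Lemma Omega0_app_inj s z w : Omega0_dom s z -> Omega0_dom s w ->
  Omega0_app s z = Omega0_app s w -> z = w.
Proof.
move=> sz sw e; have := congr1 set_val e; rewrite !Omega0_appE// => -[e1 e2].
apply: val_inj; apply/eqP/andP; split; apply/eqP.
  exact: (nz_app_inj sz sw).
exact: hat_app_inj (Omega0_dom_sigma sz) (Omega0_dom_sigma sw) e2.
Qed.

Lemma rho_continuous : continuous rho_fun.
Proof.
by move=> z; apply: (@continuous_comp Omega0 _ _ set_val fst);
  [exact: initial_continuous | exact: cvg_fst].
Qed.

Lemma sigma_continuous : continuous sigma_fun.
Proof.
by move=> z; apply: (@continuous_comp Omega0 _ _ set_val snd);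
  [exact: initial_continuous | exact: cvg_snd].
Qed.

Lemma open_Omega0_dom s : open (Omega0_dom s).
Proof.
rewrite /Omega0_dom (_ : [set z | _] = rho_fun @^-1` nz_dom s)//.
by apply: open_comp; [move=> z _; exact: rho_continuous|exact: discrete_open].
Qed.

Lemma Omega0_continuous s z : Omega0_dom s z ->
  {for z, continuous (Omega0_app s)}.
Proof.
move=> sz U [/= V [[W oW WV] Vfx VU]].
have ndom : \forall w \near z, Omega0_dom s w.
  by apply: open_nbhs_nbhs; split=> //; exact: open_Omega0_dom.
have hcvg : (fun w => (nz_app s (rho_fun w), hat_app s (sigma_fun w))) @ z -->
    (nz_app s (rho_fun z), hat_app s (sigma_fun z)).
  apply: (@cvg_pair _ _ _ (nbhs z) (nbhs (nz_app s (rho_fun z)))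
    (nbhs (hat_app s (sigma_fun z)))).
    apply: (@continuous_comp Omega0 _ _ rho_fun (nz_app s)).
      exact: rho_continuous.
    exact: nz_continuous.
  apply: (@continuous_comp Omega0 _ _ sigma_fun (hat_app s)).
    exact: sigma_continuous.
  exact/hat_continuous/Omega0_dom_sigma.
have : nbhs (nz_app s (rho_fun z), hat_app s (sigma_fun z)) W.
  rewrite -Omega0_appE//; apply: open_nbhs_nbhs; split=> //.
  by move: Vfx; rewrite -WV.
move=> /hcvg hW; have {}hW : \forall w \near z,
  W (nz_app s (rho_fun w), hat_app s (sigma_fun w)) by exact: hW.
suff : \forall w \near z, U (Omega0_app s w) by [].
by apply: filterS (filterI ndom hW) => w [sw Ww]; apply: VU; rewrite -WV /= Omega0_appE.
Qed.

Lemma Omega0_dom0 : Omega0_dom (szero : S) = set0.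
Proof. by apply/seteqP; split=> // z; rewrite /Omega0_dom/= nz_dom0. Qed.

Lemma Omega0_cover z : exists s, Omega0_dom s z.
Proof. exact: nz_cover. Qed.

Definition Omega0_action : action S Omega0 :=
  @Action S Omega0 (PartialAction Omega0_domM Omega0_appM Omega0_app_inj)
    open_Omega0_dom Omega0_continuous Omega0_dom0 Omega0_cover.

Lemma rho_app s z : Omega0_dom s z ->
  rho_fun (Omega0_app s z) = nz_app s (rho_fun z).
Proof. by move=> sz; rewrite /rho_fun Omega0_appE. Qed.

Lemma sigma_app s z : Omega0_dom s z ->
  sigma_fun (Omega0_app s z) = hat_app s (sigma_fun z).
Proof. by move=> sz; rewrite /sigma_fun Omega0_appE. Qed.

Definition rho : equivariant Omega0_action nz_action :=
  @Equivariant _ _ _ Omega0_action nz_action rho_fun (fun _ _ sz => sz) rho_app.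

Definition sigma : equivariant Omega0_action hat_action :=
  @Equivariant _ _ _ Omega0_action hat_action sigma_fun Omega0_dom_sigma
    sigma_app.

(* The chain map inducing the map in homology of the discretisation
   correspondence: pullback along the proper map given by rho, followed by
   pushforward along the local homeomorphism given by sigma. *)
Definition discretisation_chain n
    (f : chains (transformation_groupoid nz_action) n) :
    chains (transformation_groupoid hat_action) n :=
  cohz_pushforward (@nerve_map _ _ (germ_hom sigma) n)
    (cohz_pullback (@nerve_map _ _ (germ_hom rho) n) f).

End InducedActions.

Arguments discretisation_chain {S d L} a n f.

(* Main.v *)
From HB Require Import structures.
Require Import Defs.
From mathcomp Require Import all_boot all_order all_algebra.
From mathcomp Require Import all_classical all_reals all_analysis.
Set Implicit Arguments.
Unset Strict Implicit.
Unset Printing Implicit Defensive.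
Import Order.TTheory GRing.Theory.
Local Open Scope classical_set_scope.
Local Open Scope ring_scope.
Local Open Scope quotient_scope.

(** The chain map induces an isomorphism in homology because it is already an
isomorphism of chain complexes.  Write G, K and H for the transformation
groupoids of the actions on L^x, on Omega0 and on the character space, and for
a point g = ([s_1, l_1], ..., [s_n, l_n]) of the nerve of G let cell g be the
set of all ([s_1, chi_1], ..., [s_n, chi_n]) in the nerve of H with
chi_n (l_n) = 1.  As the nerve of G is discrete, its chains are freely spanned
by the indicator functions of points, and the chain map sends the indicator
function of g to that of cell g ([discretisation_delta]).

The map [rho] is a discrete fibration of groupoids: tuples lift uniquely along
it, with prescribed source ([lift_exists], [lift_uniq]) and with a prescribed
face ([face_lift_exists], [face_lift_uniq]).  Hence cell g is identified, by
the source of the last arrow, with the set of characters equal to 1 at l_n, and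
each face map restricts to a bijection from cell g to the cell of the face of g
([face_cell]); this gives compatibility with the boundaries.

Injectivity is a triangularity argument.  The principal character of l is equal
to 1 exactly at the elements above l, and l |-> principal l is S-equivariant, so
each g has a companion point in the nerve of H.  This point lies in cell g, and
it lies in cell g' only if the source of g is below that of g', with equality
of sources only for g' = g.  The image of a nonzero chain f is therefore equal
to f g at the companion of g, when g has maximal source in the support of f
([discretisation_inj]).

Surjectivity is Moebius inversion.  Restricted to a finite subset F closed
under meets, a character which does not vanish on F agrees with a principal
one ([agree_principal]).  By compactness, a compact open set of characters
which are equal to 1 at l is determined by the values on some such F, and
local finiteness allows to take F closed under meets; peeling off the values
at principal characters, from the largest element of F to the smallest, writes
its indicator function as a combination of those of the sets of characters
equal to 1 at some m <= l ([hat_at_combination]).  The source map transports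
this to the cells ([restrict_cell], [discretisation_surj]).

All topological facts rest on one observation: the source of the last arrow is
a local homeomorphism ([base_etale]), with local sections given by tuples of
elements of S.  So all nerves are ample, faces and the map induced by [sigma]
are local homeomorphisms, and pushforwards are given by sums over fibres
([pushforwardE]). *)

(** * Local homeomorphisms and ample spaces *)

Section Etale.
Implicit Types X Y Z : topologicalType.

(** As the topology of the subspace U is induced, separation can be tested with
neighbourhoods in the ambient space. *)
Lemma hausdorff_setP Y (U : set Y) : hausdorff_space U <->
  forall x y, U x -> U y ->
    (forall A B, nbhs x A -> nbhs y B -> exists z, [/\ U z, A z & B z]) ->
    x = y.
Proof.
split=> [hU x y Ux Uy xy|hU x y xy].
  suff : exist _ x (mem_set Ux) = exist _ y (mem_set Uy) :> U.
    by move=> /(congr1 set_val).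
  apply: hU => A B [A' [[A'' oA <-] Ax AA]] [B' [[B'' oB <-] By BB]].
  have [||z [Uz Az Bz]] := xy A'' B''; first exact: open_nbhs_nbhs.
    exact: open_nbhs_nbhs.
  by exists (exist _ z (mem_set Uz)); split; [exact: AA|exact: BB].
apply: val_inj; apply: hU; [exact: set_valP x|exact: set_valP y|].
move=> A B Ax By.
have [||z [Az Bz]] := xy (set_val @^-1` A) (set_val @^-1` B).
- exact: (@initial_continuous _ _ (set_val : U -> Y) x).
- exact: (@initial_continuous _ _ (set_val : U -> Y) y).
by exists (set_val z); split=> //; exact: (set_valP z).
Qed.

Lemma hausdorff_subset Y (U V : set Y) :
  V `<=` U -> hausdorff_space U -> hausdorff_space V.
Proof.
move=> VU /hausdorff_setP hU; apply/hausdorff_setP => x y Vx Vy xy.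
apply: hU; [exact: VU..|] => A B Ax By.
by have [z [Vz Az Bz]] := xy _ _ Ax By; exists z; split=> //; exact: VU.
Qed.

(** Compact subsets of a Hausdorff space are closed.  The ambient space need
not be Hausdorff, so this only holds relatively to U, and it is what makes
intersections and differences of compact open subsets of U compact open. *)
Lemma open_setD_compact Y (U V : set Y) :
  open U -> hausdorff_space U -> compact V -> V `<=` U -> open (U `\` V).
Proof.
move=> oU /hausdorff_setP hU cV VU; rewrite openE => y [Uy nVy].
apply: contrapT => nint; apply: nVy.
have clVy : closure V y.
  move=> A Ay; apply: contrapT => VA; apply: nint.
  have : nbhs y (A `&` U) by apply: filterI => //; exact: open_nbhs_nbhs.
  by apply: filterS => z [Az Uz]; split=> // Vz; apply: VA; exists z.
have pf : ProperFilter (within V (nbhs y)) by exact: within_nbhs_proper.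
have [|v [Vv clv]] := cV _ pf; first exact: withinT.
rewrite (hU y v Uy (VU _ Vv))// => A B Ay Bv.
have [||z [[Vz Az] Bz]] := clv (V `&` A) B => //.
  by rewrite /within/=; apply: filterS Ay => z Az Vz.
by exists z; split=> //; exact: VU.
Qed.

Lemma compact_finite_cover Y (K : set Y) (B : Y -> set Y) :
  compact K -> (forall y, K y -> nbhs y (B y)) ->
  exists s : seq Y, (forall y, y \in s -> K y) /\
    forall x, K x -> exists2 y, y \in s & B y x.
Proof.
move=> /compact_near_coveringP nK KB.
pose F := filter_from setT
  (fun s : seq Y => [set s' : seq Y | {subset s <= s'}]).
have FF : Filter F.
  apply: filter_from_filter; first by exists [::].
  move=> s t _ _; exists (s ++ t) => // u /= stu.
  by split=> y ys; apply: stu; rewrite mem_cat ys ?orbT.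
have [|s _ Ks] := nK _ F (fun s x => exists2 y, y \in s & K y /\ B y x) _.
  move=> x Kx; exists (B x, [set s | x \in s]) => /=.
    split; first exact: KB.
    by exists [:: x] => // s /= xs; apply: xs; rewrite inE.
  by move=> [x' s] /= [Bx xs]; exists x.
exists [seq y <- s | `[< K y >]]; split.
  by move=> y; rewrite mem_filter => /andP[/asboolP].
move=> x Kx; have [//|y ys [Ky Bx]] := Ks s _ x Kx; exists y => //.
by rewrite mem_filter ys andbT; exact/asboolP.
Qed.

Definition etale Y X (q : Y -> X) := [/\ continuous q,
  forall O, open O -> open (q @` O) &
  forall y, exists V, [/\ open V, V y & set_inj V q]].

Lemma etale_comp Z Y X (p : Z -> Y) (q : Y -> X) :
  etale p -> etale q -> etale (q \o p).
Proof.
move=> [cp op ip] [cq oq iq]; split.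
- by move=> z; apply: continuous_comp; [exact: cp|exact: cq].
- by move=> O oO; rewrite -image_comp; exact/oq/op.
move=> z; have [V [oV Vz iV]] := ip z; have [W [oW Wz iW]] := iq (p z).
exists (V `&` p @^-1` W); split=> //.
  by apply: openI => //; apply: open_comp => // x _; exact: cp.
move=> x y; rewrite !inE => -[Vx Wx] [Vy Wy] /iW e.
by apply: iV; rewrite ?inE//; apply: e; rewrite inE.
Qed.

(** The local inverses of q turn local homeomorphy of r = q \o p into that of p;
this reduces every map between nerves to maps to the space of units. *)
Lemma etale_lift Z Y X (p : Z -> Y) (q : Y -> X) (r : Z -> X) :
  (forall z, q (p z) = r z) -> continuous p -> etale q -> etale r -> etale p.
Proof.
move=> qp cp [cq oq iq] [cr oR iR]; split=> //.
- move=> O oO; rewrite openE => _ [z Oz <-].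
  have [W [oW Wz iW]] := iq (p z).
  have oV : open (O `&` p @^-1` W).
    by apply: openI => //; apply: open_comp => // x _; exact: cp.
  have : nbhs (p z) (W `&` q @^-1` (r @` (O `&` p @^-1` W))).
    apply: open_nbhs_nbhs; split; last by split=> //; exists z.
    apply: openI => //; apply: open_comp => [x _|]; first exact: cq.
    exact: oR.
  apply: filterS => w [Ww [v [Ov Wv vw]]].
  by exists v => //; apply: iW; rewrite ?inE// qp.
- move=> z; have [V [oV Vz iV]] := iR z; exists V; split=> //.
  by move=> x y Vx Vy xy; apply: iV => //; rewrite -!qp xy.
Qed.

(** The topology of V is induced by f, phrased with neighbourhoods in the
ambient spaces. *)
Definition embeds Y X (V : set Y) (f : Y -> X) :=
  forall v O, V v -> nbhs v O ->
    nbhs (f v) [set x | forall y, V y -> f y = x -> O y].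

Lemma embeds_compact Y X (V : set Y) (f : Y -> X) :
  embeds V f -> compact (f @` V) -> compact V.
Proof.
move=> eV cfV F pF FV.
have FfV : (f @ F) (f @` V).
  by apply: (@filterS _ F _ V) FV => v Vv; exists v.
have [_ [[v Vv <-] clv]] := cfV _ _ FfV.
exists v; split=> // A B FA Bv.
have [|_ [[a [Aa Va] <-] Ba]] := clv (f @` (A `&` V)) _ _ (eV _ _ Vv Bv).
  by apply: (@filterS _ F _ (A `&` V)) (filterI FA FV) => a ?; exists a.
by exists a; split=> //; exact: Ba.
Qed.

Lemma etale_embeds Y X (q : Y -> X) (V : set Y) :
  etale q -> open V -> set_inj V q -> embeds V q.
Proof.
move=> [_ oq _] oV iV v O Vv; rewrite nbhsE => -[N [oN Nv] NO].
have : nbhs (q v) (q @` (N `&` V)).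
  by apply: open_nbhs_nbhs; split; [exact/oq/openI|exists v].
apply: filterS => _ [w [Nw Vw] <-] y Vy /iV; rewrite !inE => -> //.
exact: NO.
Qed.

(** A local homeomorphism injective on V is a homeomorphism from V to its
image; with the converse [coh_preimage], this moves compact open Hausdorff sets
along local homeomorphisms. *)
Lemma coh_image Y X (q : Y -> X) (V : set Y) : etale q -> set_inj V q ->
  compact_open_hausdorff V -> compact_open_hausdorff (q @` V).
Proof.
move=> [cq oq _] iV [cV oV /hausdorff_setP hV]; split.
- apply: continuous_compact => //; apply: continuous_subspaceT; exact: cq.
- exact: oq.
apply/hausdorff_setP => _ _ [v Vv <-] [w Vw <-] vw; congr (q _).
apply: hV => // A B; rewrite !nbhsE => -[A' [oA Av] AA] [B' [oB Bw] BB].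
have [||_ [_ [a [Aa Va] <-] [b [Bb Vb]]]] :=
  vw (q @` (A' `&` V)) (q @` (B' `&` V)).
- by apply: open_nbhs_nbhs; split; [exact/oq/openI|exists v].
- by apply: open_nbhs_nbhs; split; [exact/oq/openI|exists w].
move=> /iV; rewrite !inE => /(_ Vb Va) e; exists a; split=> //.
  exact: AA.
by apply: BB; rewrite -e.
Qed.

Lemma coh_preimage Y X (q : Y -> X) (V : set Y) : etale q -> open V ->
  set_inj V q -> compact_open_hausdorff (q @` V) -> compact_open_hausdorff V.
Proof.
move=> etq oV iV [cV _ /hausdorff_setP hV]; split=> //.
  by apply: embeds_compact cV; exact: etale_embeds.
have [cq _ _] := etq.
apply/hausdorff_setP => x y Vx Vy xy; apply: iV; rewrite ?inE//.
apply: hV; [by exists x|by exists y|move=> A B Ax By].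
have [z [Vz Az Bz]] := xy _ _ (cq _ _ Ax) (cq _ _ By).
by exists (q z); split=> //; exists z.
Qed.

Definition ample Y := forall (y : Y) O, open O -> O y ->
  exists V, [/\ compact_open_hausdorff V, V y & V `<=` O].

Lemma etale_ample Y X (q : Y -> X) : etale q -> ample X -> ample Y.
Proof.
move=> etq aX y O oO Oy; have [cq oq iq] := etq.
have [W [oW Wy iW]] := iq y.
have oWO : open (W `&` O) by exact: openI.
have [|V [cV Vy VWO]] := aX (q y) _ (oq _ oWO); first by exists y.
exists (W `&` O `&` q @^-1` V); split=> //; last by move=> z [[]].
have iWOV : set_inj (W `&` O `&` q @^-1` V) q.
  by move=> a b; rewrite !inE => -[[Wa _] _] [[Wb _] _]; apply: iW; rewrite inE.
apply: (coh_preimage etq) => //.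
  apply: openI => //; apply: open_comp => [x _|]; first exact: cq.
  by case: cV.
suff -> : q @` (W `&` O `&` q @^-1` V) = V by [].
apply/seteqP; split=> [_ [x [_ Vx] <-] //|x Vx].
by have [w WOw wx] := VWO _ Vx; exists w => //; rewrite /= /preimage /= wx.
Qed.

End Etale.

(** * Functions spanned by compact open sets *)

Section Cohz.
Implicit Types X Y Z : topologicalType.

Lemma cohfun_indic Y (U : set Y) :
  compact_open_hausdorff U -> (\1_U : Y -> int) \in @cohfun Y.
Proof.
move=> cU; apply/asboolP; exists 1%N, (fun=> 1), (fun=> U); split=> //.
by rewrite big_ord1; apply/funext => y; rewrite mul1r.
Qed.

Lemma indic_mulrz Y (U : set Y) (c : int) :
  (\1_U : Y -> int) *~ c = fun y => c * \1_U y.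
Proof.
apply/funext => y; case: c => m.
  by rewrite -pmulrn natmulfctE mulrC -mulrzz.
by rewrite NegzE mulrNz mulNr -pmulrn fctE natmulfctE mulrC -mulrzz.
Qed.

(** A compact open Hausdorff set U is a finite union of compact open sets each
contained in a member of the cover C; inside U these are closed, so that U can
be cut into disjoint pieces of this kind, one at a time.  It is thus enough to
treat indicator functions of small sets. *)
Lemma cohfun_ind Y (P : (Y -> int) -> Prop) (C : set (set Y)) : ample Y ->
  (forall y, exists2 V, C V & open V /\ V y) ->
  P 0 -> (forall f g, P f -> P g -> P (f - g)) ->
  (forall U V, compact_open_hausdorff U -> C V -> U `<=` V -> P \1_U) ->
  forall f, f \in @cohfun Y -> P f.
Proof.
move=> aY cC P0 PB PC.
have PN f : P f -> P (- f) by move=> Pf; rewrite -[- f]add0r; exact: PB.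
have PD f g : P f -> P g -> P (f + g).
  by move=> Pf Pg; rewrite -[g]opprK; apply: PB => //; exact: PN.
suff PI U : compact_open_hausdorff U -> P \1_U.
  move=> _ /asboolP[n [c [U [cU ->]]]]; apply: big_ind => //= i _.
  rewrite -indic_mulrz.
  case: (c i) => m; last (rewrite NegzE mulrNz; apply: PN); rewrite -pmulrn.
    by elim: m => [|m IH]; rewrite ?mulr0n// mulrS; apply: PD => //; exact: PI.
  by elim: m.+1 => [|{}m IH]; rewrite ?mulr0n// mulrS; apply: PD => //; exact: PI.
move=> cU; have [kU oU hU] := cU.
have [B /= BE] : exists B : Y -> set Y, forall y, U y ->
    [/\ compact_open_hausdorff (B y), B y y, B y `<=` U &
      exists2 V, C V & B y `<=` V].
  suff /boolp.choice : forall y, exists B : set Y, U y ->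
      [/\ compact_open_hausdorff B, B y, B `<=` U & exists2 V, C V & B `<=` V].
    by case=> B ?; exists B.
  move=> y; have [Uy|nUy] := pselect (U y); last by exists set0 => /nUy.
  have [V CV [oV Vy]] := cC y.
  have [|//|W [cW Wy WUV]] := aY y (U `&` V); first exact: openI.
  exists W => _; split=> //; first by move=> z /WUV[].
  by exists V => // z /WUV[].
have [|s [sU Us]] := compact_finite_cover (B := B) kU.
  by move=> y /BE[[_ oB _] By _ _]; exact: open_nbhs_nbhs.
suff h W : compact_open_hausdorff W -> (forall y, y \in s -> U y) ->
    (forall x, W x -> exists2 y, y \in s & B y x) -> W `<=` U -> P \1_W.
  exact: h.
elim: s W {Us sU} => [|y s IH] W cW sU Ws WU.
  suff -> : W = set0 by rewrite indic0.
  by apply/seteqP; split=> // x /Ws[].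
have [|cBy Byy ByU [V CV BV]] := BE y; first by apply: sU; rewrite inE eqxx.
have [kW oW _] := cW; have [kB oB _] := cBy.
have cD : compact_open_hausdorff (W `\` B y).
  split; first by apply: compact_closedI => //; exact: open_closedC.
    rewrite (_ : W `\` B y = W `&` (U `\` B y)).
      by apply: openI => //; exact: open_setD_compact.
    by apply/seteqP; split=> x [Wx]; [split=> //; split=> //; exact: WU|case].
  by apply: hausdorff_subset hU => x [/WU].
have cI : compact_open_hausdorff (W `&` B y).
  split; last by apply: hausdorff_subset hU => x [/WU].
    rewrite (_ : W `&` B y = W `\` (W `\` B y)).
      by apply: compact_closedI => //; apply: open_closedC; case: cD.
    by rewrite setDD.
  exact: openI.
have -> : (\1_W : Y -> int) = \1_(W `\` B y) + \1_(W `&` B y).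
  apply/funext => x; rewrite !fctE !indicE.
  by rewrite in_setD in_setI; case: (x \in W); case: (x \in B y).
apply: PD.
  apply: IH => //; last by move=> x [/WU].
    by move=> z zs; apply: sU; rewrite inE zs orbT.
  move=> x [Wx nBx]; have [z] := Ws x Wx.
  by rewrite inE => /orP[/eqP->//|zs]; exists z.
by apply: (PC _ V) => // x [_ /BV].
Qed.

Definition fibre_sum Y Z (p : Y -> Z) (f : Y -> int) (z : Z) : int :=
  \sum_(y \in p @^-1` [set z]) f y.

(** The condition under which [fibre_sum] is a genuine sum, as sums with
infinite support are 0 by convention. *)
Definition fibre_finite Y Z (p : Y -> Z) (f : Y -> int) :=
  forall z, finite_set (p @^-1` [set z] `&` [set y | f y != 0]).

Lemma fibre_sumE Y Z (p : Y -> Z) f z (D : set Y) :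
  p @^-1` [set z] `&` [set y | f y != 0] `<=` D -> D `<=` p @^-1` [set z] ->
  fibre_sum p f z = \sum_(y \in D) f y.
Proof.
move=> fD Dp; apply/esym/fsbig_widen => // y [py nDy] /=.
by apply: contra_notP nDy => /eqP fy; exact: fD.
Qed.

Lemma fibre_finiteB Y Z (p : Y -> Z) f g :
  fibre_finite p f -> fibre_finite p g -> fibre_finite p (f - g).
Proof.
move=> pf pg z; have := conj (pf z) (pg z); rewrite -finite_setU.
apply: sub_finite_set => y [pz /= fgy].
have [fy|] := eqVneq (f y) 0; [right|by left]; split=> //=.
by apply: contra_neq fgy => gy; rewrite !fctE fy gy subr0.
Qed.

Lemma fibre_sumB Y Z (p : Y -> Z) f g : fibre_finite p f -> fibre_finite p g ->
  fibre_sum p (f - g) = fibre_sum p f - fibre_sum p g.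
Proof.
move=> pf pg; apply/funext => z.
rewrite -[RHS]/(fibre_sum p f z - fibre_sum p g z).
pose D := (p @^-1` [set z] `&` [set y | f y != 0]) `|`
          (p @^-1` [set z] `&` [set y | g y != 0]).
have fD : finite_set D by rewrite finite_setU.
have Dp : D `<=` p @^-1` [set z] by move=> y [[]|[]].
rewrite !(@fibre_sumE _ _ _ _ _ D)// ?fsbig_finite//.
- by rewrite sumrB.
- by move=> y; right.
- by move=> y; left.
move=> y [pz /= fgy].
have [fy|] := eqVneq (f y) 0; [right|by left]; split=> //=.
by apply: contra_neq fgy => gy; rewrite !fctE fy gy subr0.
Qed.

Lemma fibre_sum_indic Y Z (p : Y -> Z) (V : set Y) : set_inj V p ->
  fibre_finite p \1_V /\ fibre_sum p \1_V = \1_(p @` V).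
Proof.
move=> iV; have vE v z : V v -> p v = z ->
    p @^-1` [set z] `&` [set y | \1_V y != 0 :> int] `<=` [set v].
  move=> Vv pv y [/= py]; rewrite indicE.
  have [Vy _|] := boolP (y \in V); last by rewrite eqxx.
  by apply: iV => //; rewrite ?inE// py.
split=> [z|].
  have [[v Vv pv]|nz] := pselect ((p @` V) z).
    by apply: sub_finite_set (finite_set1 v); exact: vE.
  apply: (@sub_finite_set _ _ set0) => // y [/= py]; rewrite indicE.
  have [Vy _|] := boolP (y \in V); last by rewrite eqxx.
  by case: nz; exists y => //; rewrite inE in Vy.
apply/funext => z.
have [[v Vv pv]|nz] := pselect ((p @` V) z).
  rewrite (fibre_sumE (vE _ _ Vv pv)); last by move=> _ ->.
  by rewrite fsbig_set1 !indicE !mem_set//; exists v.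
rewrite (@fibre_sumE _ _ _ _ _ set0) ?fsbig_set0//.
  by rewrite indicE memNset.
move=> y [/= py]; rewrite indicE.
have [Vy _|] := boolP (y \in V); last by rewrite eqxx.
by case: nz; exists y => //; rewrite inE in Vy.
Qed.

Section CohzMap.
Variables (Y Z : topologicalType) (F : (Y -> int) -> (Z -> int)).
Hypothesis F_cohfun : forall f, f \in @cohfun Y -> F f \in @cohfun Z.
Hypothesis F_sub : forall f g, f \in @cohfun Y -> g \in @cohfun Y ->
  F (f - g) = F f - F g.

Let Fz (f : cohz Y) : cohz Z := Sub (F (val f)) (F_cohfun (valP f)).

Let Fz_zmod_morphism : zmod_morphism Fz.
Proof.
move=> f g; apply: val_inj; rewrite -[LHS]/(F (val f - val g)).
by rewrite F_sub ?raddfB//; exact: valP.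
Qed.

HB.instance Definition _ := GRing.isZmodMorphism.Build _ _ Fz Fz_zmod_morphism.

(** The additive map asked for by [cohz_map] exists as soon as F preserves the
span of indicator functions and is additive on it, so that the default value is
not taken. *)
Lemma cohz_mapE (f : cohz Y) : val (cohz_map F f) = F (val f).
Proof.
rewrite /cohz_map; case: pselect => [e|]; first exact: (svalP (cid e)).
by case; exists Fz => g; rewrite SubK.
Qed.

End CohzMap.

(** On an indicator function of a set on which p is injective, summation over
the fibres gives the indicator function of the image, and such functions span
everything. *)
Lemma etale_fibre_sum Y Z (p : Y -> Z) : ample Y -> etale p ->
  forall f, f \in @cohfun Y -> fibre_finite p f /\ fibre_sum p f \in @cohfun Z.
Proof.
move=> aY ep; have [cp op ip] := ep.
apply: (@cohfun_ind _ _ [set V | open V /\ set_inj V p]) => //.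
- by move=> y; have [V [oV Vy iV]] := ip y; exists V.
- have -> : (0 : Y -> int) = \1_(set0 : set Y) by rewrite indic0.
  have [|h1 h2] := @fibre_sum_indic Y Z p set0.
    by move=> x y; rewrite inE.
  by split=> //; rewrite h2 image_set0 indic0 rpred0.
- move=> f g [ff pf] [gf pg]; split; first exact: fibre_finiteB.
  by rewrite fibre_sumB// rpredB.
move=> U V cU [oV iV] UV.
have iU : set_inj U p.
  by move=> x y; rewrite !inE => /UV Vx /UV Vy; apply: iV; rewrite inE.
have [h1 h2] := fibre_sum_indic iU; split=> //; rewrite h2.
by apply: cohfun_indic; exact: coh_image.
Qed.

Lemma pushforwardE Y Z (p : Y -> Z) (f : cohz Y) : ample Y -> etale p ->
  val (cohz_pushforward p f) = fibre_sum p (val f).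
Proof.
move=> aY ep; have h := etale_fibre_sum aY ep; apply: cohz_mapE.
  by move=> g /h[].
by move=> g k /h[? _] /h[? _]; exact: fibre_sumB.
Qed.

Definition cohz_indic Y (U : set Y) (cU : compact_open_hausdorff U) : cohz Y :=
  Sub (\1_U) (cohfun_indic cU).

End Cohz.

(** * Topology of nerves and germs *)

Lemma continuous_near_eq (X Y : topologicalType) (f g : X -> Y) x :
  (\forall y \near x, f y = g y) -> {for x, continuous g} ->
  {for x, continuous f}.
Proof.
move=> fg cg U Ufx; have Ugx : nbhs (g x) U by rewrite -(nbhs_singleton fg).
have gU : \forall y \near x, U (g y) by exact: cg.
suff : \forall y \near x, U (f y) by [].
by apply: filterS2 fg gU => y ->.
Qed.

Section NerveTopology.
Variable G : groupoid.

Lemma nerve_proj_continuous m (j : 'I_m.+1) :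
  continuous (fun g : nerve G m.+1 => val g j : garr G).
Proof.
move=> g; apply: (@continuous_comp (nerve G m.+1) {ptws 'I_m.+1 -> garr G} _
  set_val (fun f => f j)); first exact: initial_continuous.
exact: (@proj_continuous 'I_m.+1 (fun=> garr G) j).
Qed.

Lemma nerve_continuous (Y : topologicalType) m (f : Y -> nerve G m.+1) y :
  (forall j, {for y, continuous (fun z => val (f z) j : garr G)}) ->
  {for y, continuous f}.
Proof.
move=> cf U [/= V [[W oW WV] Vfy VU]].
have hcvg : (fun z => val (f z) : {ptws 'I_m.+1 -> garr G}) @ y -->
    (val (f y) : {ptws 'I_m.+1 -> garr G}).
  apply/cvg_sup => j A [/= B [[C oC CB] Bfy BA]].
  have : nbhs (val (f y) j) C.
    by apply: open_nbhs_nbhs; split=> //; move: Bfy; rewrite -CB.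
  move=> /(cf j) Cj.
  have {}Cj : \forall z \near y, C (val (f z) j) by exact: Cj.
  suff : \forall z \near y, A (val (f z)) by [].
  by apply: filterS Cj => z Cz; apply: BA; rewrite -CB.
have : nbhs (val (f y) : {ptws 'I_m.+1 -> garr G}) W.
  by apply: open_nbhs_nbhs; split=> //; move: Vfy; rewrite -WV.
move=> /hcvg hW; have {}hW : \forall z \near y, W (val (f z)) by exact: hW.
suff : \forall z \near y, U (f z) by [].
by apply: filterS hW => z Wz; apply: VU; rewrite -WV.
Qed.

Lemma nerve_srcE m (g : nerve G m.+1) (i j : 'I_m.+1) : j = i.+1 :> nat ->
  gsrc (val g i) = grng (val g j).
Proof. exact: (set_valP g). Qed.

(** Being composable, a tuple is determined from its last entry to its first
one: equality of two entries forces that of the sources of the previous ones. *)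
Lemma nerve_eq m (g h : nerve G m.+1) :
  gsrc (val g ord_max) = gsrc (val h ord_max) ->
  (forall j, gsrc (val g j) = gsrc (val h j) -> val g j = val h j) -> g = h.
Proof.
move=> e0 e; suff eq k (j : 'I_m.+1) : (m = j + k)%N ->
    gsrc (val g j) = gsrc (val h j).
  apply: val_inj; apply/funext => j; apply: e.
  by apply: (eq (m - j)%N); rewrite subnKC// -ltnS.
elim: k j => [|k IH] j mE.
  suff -> : j = ord_max by [].
  by apply: val_inj; move: mE; rewrite addn0.
have jm : (j.+1 < m.+1)%N by rewrite [X in (_ < X.+1)%N]mE addnS !ltnS leq_addr.
have jE : Ordinal jm = j.+1 :> nat by [].
rewrite (nerve_srcE g jE) (nerve_srcE h jE) (e (Ordinal jm))//.
by apply: IH; rewrite /= addSnnS.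
Qed.

(** The last arrow is the one applied first, so this is the point at which the
elements of S representing a tuple start to act. *)
Definition base n : nerve G n -> gob G :=
  match n return nerve G n -> gob G with
  | 0 => id
  | m.+1 => fun g => gsrc (val g ord_max)
  end.

End NerveTopology.

Section GermTopology.
Variables (S : invSemigroupType) (X : topologicalType) (a : action S X).
Implicit Types (s t : S) (x y : X) (g h : germ_space a).

(** The bisection [s, dom s]: on it a germ is determined by its source. *)
Definition germ_at s g : Prop := exists sx : pdom a s (germ_src g), g = germ sx.

(** Total in x, with a default off the domain of s, so that continuity makes
sense as a property of a function on X. *)
Definition germ_total s x : germ_space a :=
  if pselect (pdom a s x) is left sx then germ sx else germ_one a x.

Lemma germ_totalE s x (sx : pdom a s x) : germ_total s x = germ sx.
Proof.
rewrite /germ_total; case: pselect => // sx'; apply/germ_eqP; split=> //.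
by exists s; split=> //; exact: natural_le_refl.
Qed.

Lemma germ_total_src s x : germ_src (germ_total s x) = x.
Proof. by rewrite /germ_total; case: pselect => ?; rewrite germ_srcE. Qed.

Lemma germ_atE s g : germ_at s g -> g = germ_total s (germ_src g).
Proof. by move=> [sx gE]; rewrite germ_totalE. Qed.

Lemma germ_at_germ s x (sx : pdom a s x) : germ_at s (germ sx).
Proof.
have sx' : pdom a s (germ_src (germ sx)) by rewrite germ_srcE.
exists sx'; apply/germ_eqP; rewrite germ_srcE; split=> //.
by exists s; split=> //; exact: natural_le_refl.
Qed.

Lemma germ_at_total s x : pdom a s x -> germ_at s (germ_total s x).
Proof. by move=> sx; rewrite germ_totalE; exact: germ_at_germ. Qed.

Lemma germ_at_dom s g : germ_at s g -> pdom a s (germ_src g).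
Proof. by case. Qed.

Lemma germ_at_rng s g : germ_at s g -> germ_rng g = papp a s (germ_src g).
Proof. by move=> [sx ->]; rewrite germ_rngE germ_srcE. Qed.

Lemma germ_at_inj s g h : germ_at s g -> germ_at s h ->
  germ_src g = germ_src h -> g = h.
Proof. by move=> /germ_atE -> /germ_atE ->; rewrite !germ_total_src => ->. Qed.

Lemma germ_at_repr g : germ_at (val (repr g)).1 g.
Proof. by have [sx _ gE] := germ_reprE g; exists sx. Qed.

Lemma germ_at_mul t s g h : germ_at t g -> germ_at s h ->
  germ_src g = germ_rng h -> germ_at (t * s)%g (germ_mul g h).
Proof.
move=> tg sh gh.
have tsx : pdom a (t * s)%g (germ_src h).
  rewrite pdomM; split; first exact: germ_at_dom.
  by rewrite -germ_at_rng// -gh; exact: germ_at_dom.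
have e : germ_src g = papp a s (germ_src h) by rewrite -germ_at_rng.
move: tg sh tsx e => [ty ->] [sx ->]; rewrite !germ_srcE => tsx e.
by rewrite (germ_mulE _ _ tsx)//; exact: germ_at_germ.
Qed.

Lemma germ_total_continuous s x : pdom a s x ->
  {for x, continuous (germ_total s)}.
Proof.
move=> sx U; rewrite nbhsE => -[V [oV Vx] VU].
have [W oW WV] : open (\pi_(germ_space a) @^-1` V) by exact: oV.
have Wx : W (s : discrete_topology S, x).
  have : (\pi_(germ_space a) @^-1` V) (exist _ (s, x) (mem_set sx) : germ_rep a).
    by move: Vx; rewrite (germ_totalE sx).
  by rewrite -WV.
have hcvg : (fun y => (s : discrete_topology S, y)) @ x -->
    (s : discrete_topology S, x).
  apply: (@cvg_pair _ _ _ (nbhs x) (nbhs (s : discrete_topology S)) (nbhs x)).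
    exact: cvg_cst.
  exact: cvg_id.
have : nbhs (s : discrete_topology S, x) W by apply: open_nbhs_nbhs.
move=> /hcvg hW.
have {}hW : \forall y \near x, W (s : discrete_topology S, y) by exact: hW.
have ndom : \forall y \near x, pdom a s y.
  by apply: open_nbhs_nbhs; split=> //; exact: open_pdom.
suff : \forall y \near x, U (germ_total s y) by [].
apply: filterS2 ndom hW => y sy Wy; apply: VU; rewrite (germ_totalE sy).
suff : (\pi_(germ_space a) @^-1` V) (exist _ (s, y) (mem_set sy) : germ_rep a).
  by [].
by rewrite -WV.
Qed.

Lemma germ_rep1_continuous :
  continuous (fun q : germ_rep a => (val q).1 : discrete_topology S).
Proof.
move=> p; apply: (@continuous_comp (germ_rep a) (discrete_topology S * X)%type
  (discrete_topology S) set_val fst p); first exact: initial_continuous.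
exact: cvg_fst.
Qed.

Lemma germ_rep2_continuous : continuous (fun q : germ_rep a => (val q).2 : X).
Proof.
move=> p; apply: (@continuous_comp (germ_rep a) (discrete_topology S * X)%type
  X set_val snd p); first exact: initial_continuous.
exact: cvg_snd.
Qed.

Lemma open_germ_at s : open (germ_at s).
Proof.
suff : open (\pi_(germ_space a) @^-1` (germ_at s)) by [].
rewrite openE => p /= [sx pE].
have /eqmodP/asboolP[e [u [up us ux]]] := pE.
have n1 : \forall q \near p, (val q).1 = (val p).1.
  exact: (germ_rep1_continuous (discrete_set1 _)).
have n2 : \forall q \near p, pdom a u (val q).2.
  apply: (@germ_rep2_continuous p).
  by apply: open_nbhs_nbhs; split=> //; exact: open_pdom.
apply: filterS2 n1 n2 => q q1 uq.
have sq : pdom a s (val q).2 by exact: pdom_nle uq.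
change (germ_at s (\pi_(germ_space a) q)).
suff -> : \pi_(germ_space a) q = germ sq by exact: germ_at_germ.
by apply/eqmodP/asboolP; split=> //; exists u; rewrite q1.
Qed.

Lemma germ_src_continuous : continuous (@germ_src _ _ a).
Proof.
apply/quotient_continuous.
suff -> : @germ_src _ _ a \o \pi_(germ_space a) = fun q => (val q).2.
  exact: germ_rep2_continuous.
apply/funext => q /=.
have -> : \pi_(germ_space a) q = germ (set_valP q).
  by congr (\pi_(germ_space a)); apply: val_inj; case: q => -[].
exact: germ_srcE.
Qed.

Lemma near_germ_at s g : germ_at s g -> \forall h \near g, germ_at s h.
Proof.
by move=> sg; apply: open_nbhs_nbhs; split=> //; exact: open_germ_at.
Qed.

Lemma germ_rng_continuous : continuous (@germ_rng _ _ a).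
Proof.
move=> g; have sg := germ_at_repr g.
apply: (@continuous_near_eq _ _ _ (papp a (val (repr g)).1 \o @germ_src _ _ a)).
  by apply: filterS (near_germ_at sg) => h /germ_at_rng.
apply: continuous_comp; first exact: germ_src_continuous.
by apply: continuous_papp; exact: germ_at_dom.
Qed.

End GermTopology.

Section GermMap.
Variables (S : invSemigroupType) (X Y : topologicalType).
Variables (a : action S X) (b : action S Y) (f : equivariant a b).

Lemma germ_at_map s g : germ_at s g -> germ_at s (germ_map f g).
Proof.
move=> [sx ->]; have sfx := emap_dom f sx.
by rewrite (germ_mapE _ sfx); exact: germ_at_germ.
Qed.

Lemma germ_map_continuous : continuous f -> continuous (germ_map f).
Proof.
move=> cf g; have sg := germ_at_repr g.
apply: (@continuous_near_eq _ _ _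
  (germ_total b (val (repr g)).1 \o (f \o @germ_src _ _ a))).
  apply: filterS (near_germ_at sg) => h /germ_at_map /germ_atE.
  by rewrite germ_map_src.
apply: continuous_comp.
  by apply: continuous_comp; [exact: germ_src_continuous|exact: cf].
by apply: germ_total_continuous; apply: emap_dom; exact: germ_at_dom.
Qed.

End GermMap.

(** * Tuples of germs represented by sequences *)

Lemma sinvK (S : invSemigroupType) (s : S) : sinv (sinv s) = s.
Proof. by apply/esym/sinv_uniq; [exact: mulVsV|exact: mulsVs]. Qed.

Lemma pappVK (S : invSemigroupType) X (a : partial_action S X) s x :
  pdom a (sinv s) x -> papp a s (papp a (sinv s) x) = x.
Proof. by move=> sx; rewrite -[X in papp a X]sinvK pappK. Qed.

Lemma near_open (X : topologicalType) (x : X) (P : X -> Prop) :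
  (\forall y \near x, P y) -> exists V, [/\ open V, V x & V `<=` P].
Proof.
move=> xP; have : nbhs x P by exact: xP.
by rewrite nbhsE => -[V [oV Vx] VP]; exists V.
Qed.

Section Representatives.
Variables (S : invSemigroupType) (X : topologicalType) (a : action S X).
Local Notation G := (transformation_groupoid a).
Implicit Types (s : seq S) (x : X).

(** The points to which the elements of s can be applied successively, starting
from the last one. *)
Fixpoint seq_dom s x : Prop :=
  if s is t :: s' then seq_dom s' x /\ pdom a t (foldr (papp a) x s') else True.

Lemma seq_dom_drop s x n : seq_dom s x -> seq_dom (drop n s) x.
Proof.
elim: n s => [|n IH] [|t s]; rewrite ?drop0//.
by move=> [sx _]; exact: IH.
Qed.

Lemma seq_dom_nth s x j : (j < size s)%N -> seq_dom s x ->
  pdom a (nth szero s j) (foldr (papp a) x (drop j.+1 s)).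
Proof.
elim: s j => // t s IH [|j] /= js [sx tx]; first by rewrite drop0.
exact: IH.
Qed.

Lemma seq_dom_near s x : seq_dom s x ->
  (\forall y \near x, seq_dom s y) /\ {for x, continuous (foldr (papp a) ^~ s)}.
Proof.
elim: s => [_|t s IH /= [/IH[ns cs] tx]].
  by split; [exact: nearW|exact: cvg_id].
split.
  have nt : \forall z \near foldr (papp a) x s, pdom a t z.
    by apply: open_nbhs_nbhs; split=> //; exact: open_pdom.
  by apply: filterS2 ns (cs _ nt) => y.
apply: (@continuous_comp _ _ _ (foldr (papp a) ^~ s) (papp a t)) => //.
exact: continuous_papp.
Qed.

(** The tuple g is obtained by applying the elements of s successively to x: its
j-th entry is the germ of the j-th element of s at the image of x under the
elements after it. *)
Definition represents n s x : nerve G n -> Prop :=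
  match n return nerve G n -> Prop with
  | 0 => fun g => g = x
  | m.+1 => fun g => forall j : 'I_m.+1,
      germ_at (nth szero s j) (val g j : germ_space a) /\
      germ_src (val g j) = foldr (papp a) x (drop j.+1 s)
  end.

Lemma represents_base n s x (g : nerve G n) :
  size s = n -> represents s x g -> base g = x.
Proof.
case: n g => [|n] g sn //= /(_ ord_max)[_ ->].
by rewrite drop_oversize// sn.
Qed.

Lemma represents_uniq n s x (g h : nerve G n) :
  represents s x g -> represents s x h -> g = h.
Proof.
case: n g h => [|n] g h /=; first by move=> -> ->.
move=> sg sh; apply: val_inj; apply/funext => j.
have [gj ej] := sg j; have [hj fj] := sh j.
by apply: germ_at_inj gj hj _; rewrite ej fj.
Qed.

Lemma represents_dom n s x (g : nerve G n) :
  size s = n -> represents s x g -> seq_dom s x.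
Proof.
case: n g => [|n] g; first by move/size0nil ->.
move=> sn gs.
have h j : (j < size s)%N ->
    pdom a (nth szero s j) (foldr (papp a) x (drop j.+1 s)).
  rewrite sn => jn; have [/germ_at_dom + e] := gs (Ordinal jn).
  by rewrite e.
elim: s h {sn gs} => //= t s IH h; split.
  by apply: IH => j js; exact: (h j.+1).
by have := h 0 isT; rewrite /= drop0.
Qed.

Lemma represents_exists n s x : size s = n -> seq_dom s x ->
  exists g : nerve G n, represents s x g.
Proof.
case: n => [_ _|n sn sx]; first by exists x.
pose f (j : 'I_n.+1) : garr G :=
  germ_total a (nth szero s j) (foldr (papp a) x (drop j.+1 s)).
have sd j : (j < n.+1)%N ->
    pdom a (nth szero s j) (foldr (papp a) x (drop j.+1 s)).
  by move=> jn; apply: seq_dom_nth => //; rewrite sn.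
have cf : composable f.
  move=> i j ij; rewrite /f /= germ_total_src.
  rewrite (germ_at_rng (germ_at_total (sd _ (ltn_ord j)))) germ_total_src ij.
  by rewrite (drop_nth szero (n := i.+1)) ?sn -?ij.
exists (exist _ f (mem_set cf)) => j; rewrite /f /= germ_total_src; split=> //.
exact/germ_at_total/sd.
Qed.

Lemma nerve_represents n (g : nerve G n) :
  exists2 s, size s = n & represents s (base g) g.
Proof.
case: n g => [|n] g; first by exists [::].
pose t (j : 'I_n.+1) : S := (val (repr (val g j : germ_space a))).1.
exists (mkseq (fun j => t (inord j)) n.+1); rewrite ?size_mkseq// => j.
rewrite nth_mkseq// inord_val; split; first exact: germ_at_repr.
suff h k (i : 'I_n.+1) : (n = i + k)%N -> germ_src (val g i : germ_space a) =
    foldr (papp a) (base g) (drop i.+1 (mkseq (fun j => t (inord j)) n.+1)).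
  by apply: (h (n - j)%N); rewrite subnKC// -ltnS.
elim: k i => [|k IH] i nE.
  have -> : i = ord_max by apply: val_inj; move: nE; rewrite addn0.
  by rewrite drop_oversize ?size_mkseq.
have jn : (i.+1 < n.+1)%N by rewrite [X in (_ < X.+1)%N]nE addnS !ltnS leq_addr.
rewrite (drop_nth szero) ?size_mkseq// nth_mkseq//=.
rewrite -(IH (Ordinal jn)); last by rewrite /= addSnnS.
have -> : inord i.+1 = Ordinal jn by apply: val_inj; rewrite /= inordK.
exact: (nerve_srcE g (i := i) (j := Ordinal jn)).
Qed.

Lemma near_nerve_germ_at n t (g : nerve G n.+1) (j : 'I_n.+1) :
  germ_at t (val g j : germ_space a) ->
  \forall h \near g, germ_at t (val (h : nerve G n.+1) j : germ_space a).
Proof.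
move=> tg; exact: (@nerve_proj_continuous _ _ j g _ (near_germ_at tg)).
Qed.

(** A sequence s gives a continuous section over [seq_dom] s, which shows that
[base] is open; it is injective on the open set of tuples whose j-th entry is a
germ of the j-th element of s. *)
Lemma base_etale n : etale (@base G n).
Proof.
case: n => [|n].
  split.
  - by move=> x; exact: cvg_id.
  - move=> O oO; rewrite (_ : _ @` O = O)//.
    by apply/seteqP; split=> [_ [x Ox <-]//|x Ox]; exists x.
  - by move=> y; exists setT; split=> //; exact: openT.
have cb : continuous (@base G n.+1).
  move=> g; apply: (@continuous_comp _ (germ_space a) _
    (fun g : nerve G n.+1 => val g ord_max)).
    exact: nerve_proj_continuous.
  exact: germ_src_continuous.
split=> [//||g]; first move=> O oO.
  rewrite openE => _ [g Og <-]; have [s sn gs] := nerve_represents g.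
  have sx := represents_dom sn gs.
  pose sec y : nerve G n.+1 :=
    if pselect (seq_dom s y) is left sy then
      sval (cid (represents_exists sn sy)) else g.
  have secP y : seq_dom s y -> represents s y (sec y).
    by move=> sy; rewrite /sec; case: pselect => // ?; case: cid.
  have [ns cs] := seq_dom_near sx.
  have secg : sec (base g) = g by exact: represents_uniq (secP _ sx) gs.
  have csec : {for base g, continuous sec}.
    apply: nerve_continuous => j; apply: (@continuous_near_eq _ _ _
       (germ_total a (nth szero s j) \o (foldr (papp a) ^~ (drop j.+1 s)))).
      apply: filterS ns => y /secP/(_ j)[yj ej] /=.
      by rewrite -ej; exact: germ_atE.
    have [_ csj] := seq_dom_near (seq_dom_drop j.+1 sx).
    apply: continuous_comp; first exact: csj.
    by apply: germ_total_continuous; apply: seq_dom_nth => //; rewrite sn.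
  have nO : nbhs (sec (base g)) O by rewrite secg; exact: open_nbhs_nbhs.
  apply: filterS2 ns (csec _ nO) => y sy Oy; exists (sec y) => //.
  exact: represents_base (secP _ sy).
have [s sn gs] := nerve_represents g.
have nV : \forall h \near g, forall j : 'I_n.+1,
    germ_at (nth szero s j) (val (h : nerve G n.+1) j : germ_space a).
  apply: (@filter_forall _ _ (fun (j : 'I_n.+1) (h : nerve G n.+1) =>
    germ_at (nth szero s j) (val h j : germ_space a)) (nbhs g)) => j.
  have [sj _] := gs j.
  exact: near_nerve_germ_at.
have [V [oV Vg VE]] := near_open nV; exists V; split=> // h k.
rewrite !inE => /VE hs /VE ks hk; apply: nerve_eq => // j.
exact: germ_at_inj (hs j) (ks j).
Qed.

(** The last face forgets the arrow applied first, and this is where it sends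
the base point; the other faces preserve [base]. *)
Definition last_rng n (g : nerve G n.+1) : X := germ_rng (val g ord_max).

(** Near g it is the composite of [base] with the partial homeomorphism of an
element of S. *)
Lemma last_rng_etale n : etale (@last_rng n).
Proof.
have [cb ob ib] := base_etale n.+1.
have nlast (g : nerve G n.+1) : exists t, [/\ pdom a t (base g),
    last_rng g = papp a t (base g) &
    \forall h \near g, germ_at t (val h ord_max : germ_space a)].
  have tg := germ_at_repr (val g ord_max : germ_space a).
  exists (val (repr (val g ord_max : germ_space a))).1; split.
  - exact: germ_at_dom tg.
  - exact: germ_at_rng tg.
  - exact: near_nerve_germ_at.
split.
- move=> g; apply: (@continuous_comp _ (germ_space a) _
    (fun g : nerve G n.+1 => val g ord_max)).
    exact: nerve_proj_continuous.
  exact: germ_rng_continuous.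
- move=> O oO; rewrite openE => _ [g Og <-].
  have [t [tg rE nt]] := nlast g.
  have [V [oV Vg VE]] := near_open nt.
  have tr : pdom a (sinv t) (last_rng g) by rewrite rE; exact: pdom_sinv.
  have nd : \forall w \near last_rng g, pdom a (sinv t) w.
    by apply: open_nbhs_nbhs; split=> //; exact: open_pdom.
  have nb : nbhs (papp a (sinv t) (last_rng g)) (@base G n.+1 @` (O `&` V)).
    rewrite rE pappK//; apply: open_nbhs_nbhs.
    by split; [exact/ob/openI|exists g].
  apply: filterS2 nd (continuous_papp tr nb) => w tw [h [Oh Vh] hw].
  exists h => //; rewrite /last_rng (germ_at_rng (VE _ Vh)).
  by rewrite -[germ_src _]/(base h) hw pappVK.
- move=> g; have [W [oW Wg iW]] := ib g; have [t [tg rE nt]] := nlast g.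
  have [V [oV Vg VE]] := near_open nt.
  exists (W `&` V); split=> //; first exact: openI.
  move=> h k; rewrite !inE => -[Wh /VE th] [Wk /VE tk].
  rewrite /last_rng (germ_at_rng th) (germ_at_rng tk).
  move=> hk; apply: iW; rewrite ?inE//.
  by apply: papp_inj hk; exact: germ_at_dom.
Qed.

Lemma face_continuous n (i : 'I_n.+2) : continuous (@face G n i).
Proof.
have cp m (j : 'I_m.+1) := @nerve_proj_continuous G m j.
case: n i => [|n] i g.
  have [->|i0] := eqVneq i ord0.
    apply: (@continuous_comp _ (germ_space a) _
      (fun h : nerve G 1 => val h ord0) (@germ_src _ _ a)); first exact: cp.
    exact: germ_src_continuous.
  have -> : @face G 0 i = @germ_rng _ _ a \o (fun h => val h ord0).
    by apply/funext => h; rewrite /face (negbTE i0).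
  by apply: continuous_comp; [exact: cp|exact: germ_rng_continuous].
apply: nerve_continuous => j; rewrite /face /= /face_tuple.
case: (j.+1 < i)%N; first exact: cp.
case: (j.+1 == i :> nat); last exact: cp.
set j0 := widen_ord _ j; set j1 := lift ord0 j.
have j01 (h : nerve G n.+2) :
    germ_src (val h j0 : germ_space a) = germ_rng (val h j1).
  exact: (nerve_srcE h (i := j0) (j := j1)).
have t0 := germ_at_repr (val g j0 : germ_space a).
have t1 := germ_at_repr (val g j1 : germ_space a).
set s0 := (val (repr _)).1 in t0; set s1 := (val (repr _)).1 in t1.
apply: (@continuous_near_eq _ _ _
  (germ_total a (s0 * s1)%g \o
    (@germ_src _ _ a \o (fun h : nerve G n.+2 => val h j1)))).
  apply: filterS2 (near_nerve_germ_at t0) (near_nerve_germ_at t1) => h h0 h1 /=.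
  rewrite (germ_atE (germ_at_mul h0 h1 (j01 h))).
  by rewrite germ_srcM// germ_total_src.
have cs : {for g, continuous
    (@germ_src _ _ a \o (fun h : nerve G n.+2 => val h j1))}.
  by apply: continuous_comp; [exact: cp|exact: germ_src_continuous].
apply: continuous_comp; first exact: cs.
apply: germ_total_continuous.
have := germ_at_dom (germ_at_mul t0 t1 (j01 g)).
by rewrite germ_srcM.
Qed.

Lemma base_face n (i : 'I_n.+2) (g : nerve G n.+1) :
  (i < n.+1)%N -> base (face i g) = base g.
Proof.
case: n i g => [|n] i g ilt.
  have -> : i = ord0 by apply/val_inj/eqP; rewrite /= -leqn0 -ltnS.
  by rewrite /base (_ : ord_max = ord0)//; exact: val_inj.
rewrite /base /face /= /face_tuple /=.
have e : lift ord0 ord_max = ord_max :> 'I_n.+2 by exact: val_inj.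
rewrite ltnNge -ltnS ilt /=; case: ifP => _; rewrite e//.
apply: germ_srcM.
exact: (nerve_srcE g (i := widen_ord _ _) (j := ord_max)).
Qed.

Lemma base_face_max n (g : nerve G n.+1) : base (face ord_max g) = last_rng g.
Proof.
case: n g => [|n] g.
  by congr (germ_rng (val g _)); exact: val_inj.
rewrite /base /face /= /face_tuple /= ltnS leqnn.
exact: (nerve_srcE g (i := widen_ord _ _) (j := ord_max)).
Qed.

(** Composed with [base], a face map is [base] or [last_rng]. *)
Lemma face_etale n (i : 'I_n.+2) : etale (@face G n i).
Proof.
have [ilt|] := ltnP i n.+1.
  apply: (@etale_lift _ _ _ _ (@base G n) (@base G n.+1)).
  - by move=> g; exact: base_face.
  - exact: face_continuous.
  - exact: base_etale.
  - exact: base_etale.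
move=> ni; have -> : i = ord_max.
  by apply: val_inj; apply/eqP; rewrite eqn_leq ni -ltnS ltn_ord.
apply: (@etale_lift _ _ _ _ (@base G n) (@last_rng n)).
- exact: base_face_max.
- exact: face_continuous.
- exact: base_etale.
- exact: last_rng_etale.
Qed.

End Representatives.

Section NerveMap.
Variables (S : invSemigroupType) (X Y : topologicalType).
Variables (a : action S X) (b : action S Y) (f : equivariant a b).

Lemma seq_dom_map s x : seq_dom a s x ->
  seq_dom b s (f x) /\ foldr (papp b) (f x) s = f (foldr (papp a) x s).
Proof.
elim: s => //= t s IH [/IH[sx e] tx]; rewrite e emap_app//.
by do ![split=> //]; exact: emap_dom.
Qed.

Lemma base_map n (g : nerve _ n) :
  base (nerve_map (germ_hom f) g) = f (base g).
Proof. by case: n g => // n g; exact: germ_map_src. Qed.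

Lemma represents_map n s x (g : nerve (transformation_groupoid a) n) :
  size s = n -> represents s x g ->
  represents s (f x) (nerve_map (germ_hom f) g).
Proof.
move=> sn gs; have sx := represents_dom sn gs.
case: n g sn gs => [|n] g sn /= gs; first by rewrite gs.
move=> j; have [gj ej] := gs j; split; first exact: germ_at_map.
by rewrite germ_map_src ej; have [_ ->] := seq_dom_map (seq_dom_drop j.+1 sx).
Qed.

Lemma nerve_map_continuous n : continuous f ->
  continuous (@nerve_map _ _ (germ_hom f) n).
Proof.
move=> cf; case: n => [//|n] g; apply: nerve_continuous => j.
apply: (@continuous_comp _ (germ_space a) (germ_space b)
    (fun h : nerve (transformation_groupoid a) n.+1 => val h j) (germ_map f)).
  exact: nerve_proj_continuous.
exact: germ_map_continuous.
Qed.

Lemma nerve_map_etale n : etale f -> etale (@nerve_map _ _ (germ_hom f) n).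
Proof.
move=> ef; have [cf _ _] := ef.
apply: (@etale_lift _ _ Y _ (@base (transformation_groupoid b) n)
  (f \o @base (transformation_groupoid a) n)).
- exact: base_map.
- exact: nerve_map_continuous.
- exact: base_etale.
- by apply: etale_comp ef; exact: base_etale.
Qed.

Lemma face_map n (i : 'I_n.+2) (g : nerve (transformation_groupoid a) n.+1) :
  face i (nerve_map (germ_hom f) g) = nerve_map (germ_hom f) (face i g).
Proof.
case: n i g => [|n] i g.
  rewrite /face /=; case: ifP => _; first exact: germ_map_src.
  exact: germ_map_rng.
apply: val_inj; apply/funext => j; rewrite /= /face_tuple.
case: ifP => // _; case: ifP => // _; apply/esym/germ_mapM.
exact: (nerve_srcE g (i := widen_ord _ _) (j := lift ord0 _)).
Qed.

End NerveMap.

(** * The space of characters *)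

(** Applied to the support of a chain, with the base point as key, and to finite
sets of elements of L. *)
Lemma seq_max d (P : porderType d) (T : eqType) (key : T -> P) (s : seq T) x0 :
  x0 \in s ->
  exists2 x, x \in s & forall y, y \in s -> (key x < key y)%O = false.
Proof.
elim: s x0 => // z s IH x0 _.
case: s IH => [_|y s /(_ y (mem_head _ _))[x xs xmax]].
  by exists z; rewrite ?inE// => y; rewrite inE => /eqP->; exact: ltxx.
have [xz|xz] := boolP (key x < key z)%O.
  exists z; first by rewrite inE eqxx.
  move=> u; rewrite inE => /orP[/eqP->|us]; first exact: ltxx.
  by apply/negP => zu; have := xmax _ us; rewrite (lt_trans xz zu).
exists x; first by rewrite inE xs orbT.
by move=> u; rewrite inE => /orP[/eqP->|/xmax//]; exact: negbTE.
Qed.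

Section HatTopology.
Context {d : Order.disp_t} {L : weakSemilatticeType d}.
Implicit Types (k l m : L) (chi psi phi : hat L) (s F : seq L).

Definition hat_at l : set (hat L) := [set chi | ev chi l].

Definition agree s chi psi := forall k, k \in s -> ev psi k = ev chi k.

Lemma near_agree s chi : \forall psi \near chi, agree s chi psi.
Proof.
elim: s => [|k s IH].
  by apply: filterS filterT => psi _ k; rewrite in_nil.
apply: filterS2 (near_eval chi k) IH => psi ck cs l.
by rewrite inE => /orP[/eqP->//|/cs].
Qed.

Lemma open_hat_at l : open (hat_at l).
Proof.
rewrite openE => chi cl.
by apply: filterS (near_eval chi l) => psi; rewrite /hat_at /= => ->.
Qed.

Lemma hat_ext chi psi : (forall k, ev chi k = ev psi k) -> chi = psi.
Proof. by move=> e; apply: val_inj; apply/funext. Qed.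

Lemma hat_hausdorff (U : set (hat L)) : hausdorff_space U.
Proof.
apply/hausdorff_setP => chi psi _ _ h; apply: hat_ext => k.
have [phi [_]] := h _ _ (near_eval chi k) (near_eval psi k).
by rewrite /= => <-.
Qed.

(** The set of maximal common lower bounds is finite, being contained in every
finite set which dominates all common lower bounds. *)
Lemma meets_mem k l (A : seq L) :
  (forall m, m \in A -> (m <= k)%O /\ (m <= l)%O) ->
  (forall m, (m <= k)%O -> (m <= l)%O -> exists2 a, a \in A & (m <= a)%O) ->
  forall m, Defs.meets k l m -> m \in A.
Proof.
move=> Akl Amax m [mk ml mmax]; have [a aA ma] := Amax m mk ml.
by have [ak al] := Akl a aA; rewrite -(mmax a).
Qed.

Lemma near_ptws (f : {ptws L -> bool}) s :
  \forall g \near f, forall k, k \in s -> g k = f k.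
Proof.
elim: s => [|k s IH].
  by apply: filterS filterT => psi _ k; rewrite in_nil.
have nk : \forall g \near f, g k = f k.
  exact: (@proj_continuous L (fun=> bool) k f _ (discrete_set1 (f k))).
apply: filterS2 nk IH => g gk gs l.
by rewrite inE => /orP[/eqP->//|/gs].
Qed.

(** As meets are finite sets, each of the conditions defining a character with
value 1 at l involves finitely many values only, so these characters form a
closed subset of the compact space of all maps to bool. *)
Lemma compact_hat_at l : compact (hat_at l).
Proof.
apply: (@embeds_compact _ {ptws L -> bool} _
  (set_val : hat L -> {ptws L -> bool})).
  move=> chi O cl [/= V [[W oW WV] Vc VO]].
  have : nbhs (set_val chi : {ptws L -> bool}) W.
    by apply: open_nbhs_nbhs; split=> //; move: Vc; rewrite -WV.
  apply: filterS => f Wf psi _ pf; apply: VO; rewrite -WV /=.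
  by rewrite /preimage /= pf.
have cube : compact [set f : {ptws L -> bool} | forall k, [set: bool] (f k)].
  exact: (@tychonoff L (fun=> bool) (fun=> [set: bool]) (fun=> bool_compact)).
apply: subclosed_compact cube _; last by [].
move=> f clf.
have {}clf s : exists2 chi, ev chi l & forall k, k \in s -> ev chi k = f k.
  have [_ [[chi cl <-] h]] := clf _ (near_ptws f s).
  by exists chi => // k /h.
have fl : f l.
  by have [chi cl /(_ l)] := clf [:: l]; rewrite inE => <-.
suff cf : is_character f by exists (exist _ f (mem_set cf)).
split; first by exists l.
  have [chi cl /(_ \bot%O)] := clf [:: \bot%O]; rewrite inE => <-//.
  by have [_ c0 _] := set_valP chi; rewrite [ev _ _]c0.
move=> k m; have [A [Akm Amax]] := weak_meet k m; split=> [[fk fm]|[n km fn]].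
  have [chi cl h] := clf [:: k, m & A].
  have [_ _ /(_ k m)[[|n kmn cn _]]] := set_valP chi.
    by rewrite ![val _ _]h ?inE ?eqxx ?orbT.
  exists n => //; rewrite -h//.
  by rewrite !inE (meets_mem Akm Amax kmn) !orbT.
have [chi cl h] := clf [:: k; m; n].
have [_ _ /(_ k m)[_ []]] := set_valP chi.
  by exists n => //; rewrite [val _ _]h ?inE ?eqxx ?orbT.
by rewrite ![val _ _]h ?inE ?eqxx ?orbT.
Qed.

Lemma coh_hat_at l : compact_open_hausdorff (hat_at l).
Proof.
by split; [exact: compact_hat_at|exact: open_hat_at|exact: hat_hausdorff].
Qed.

Lemma hat_nonzero chi l : ev chi l -> l != \bot%O.
Proof.
by have [_ c0 _] := set_valP chi; apply: contraTneq => ->; rewrite [ev _ _]c0.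
Qed.

(** The part of [hat_at] l outside O is compact, where chi l = 1, and each of
its points differs from chi at some element of L: finitely many elements of L
separate it from chi. *)
Lemma hat_basis chi (O : set (hat L)) : open O -> O chi ->
  exists2 s, has (ev chi) s & forall psi, agree s chi psi -> O psi.
Proof.
move=> oO Oc; have [[l cl] _ _] := set_valP chi.
have cK : compact (hat_at l `&` ~` O).
  by apply: compact_closedI; [exact: compact_hat_at|exact: open_closedC].
have /boolp.choice[b bE] : forall psi, exists k,
    psi <> chi -> ev psi k <> ev chi k.
  move=> psi; apply: contrapT => /forallNP h; have h0 := h l.
  move/not_implyP: h0 => [pc _]; apply: pc; apply: hat_ext => k.
  by have /not_implyP[_ /contrapT] := h k.
have [|t [tK Kt]] := @compact_finite_cover _ _
    (fun psi => [set phi | ev phi (b psi) = ev psi (b psi)]) cK.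
  by move=> psi _; exact: near_eval.
exists (l :: map b t); first by rewrite /= [ev _ _]cl.
move=> psi cp; apply: contrapT => nO.
have pl : ev psi l by rewrite cp ?inE ?eqxx//; exact: cl.
have [//|phi phit /= e] := Kt psi.
have pc : phi <> chi by move=> h; have [_] := tK _ phit; rewrite h.
apply: (bE _ pc); rewrite -e cp// inE map_f ?orbT//.
Qed.

Lemma hat_ample : ample (hat L).
Proof.
move=> chi O oO Oc; have [s /hasP[l ls cl] sO] := hat_basis oO Oc.
exists [set psi | agree s chi psi]; split=> //.
split; last exact: hat_hausdorff.
- rewrite (_ : [set psi | _] = hat_at l `&` [set psi | agree s chi psi]).
    apply: compact_closedI; first exact: compact_hat_at.
    move=> psi clp k ks.
    have [phi [/(_ k ks) <- /= h]] := clp _ (near_eval psi k).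
    by rewrite h.
  apply/seteqP; split=> [psi cp|psi []//]; split=> //.
  by rewrite /hat_at /= (cp _ ls).
- rewrite openE => psi cp; apply: filterS (near_agree s psi) => phi h k ks.
  by rewrite h// cp.
Qed.

Lemma principal_subproof (l : nonzero L) :
  is_character (fun k => (val l <= k)%O).
Proof.
split; first by exists (val l).
  by apply/negbTE; rewrite lex0; exact: (valP l).
move=> k m; split=> [[lk lm]|[n [nk nm _] ln]].
  by have [n kmn ln] := Defs.meets_max lk lm; exists n.
by split; apply: le_trans ln _.
Qed.

Definition principal (l : nonzero L) : hat L :=
  exist _ (fun k => (val l <= k)%O : bool) (mem_set (principal_subproof l)).

Lemma ev_principal (l : nonzero L) k : ev (principal l) k = (val l <= k)%O.
Proof. by []. Qed.

Definition meet_closed F :=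
  forall k l m, k \in F -> l \in F -> Defs.meets k l m -> m \in F.

(** The elements of F at which chi is 1 are downward directed, by closedness
under meets, and finite in number; so they have a least element. *)
Lemma agree_principal F chi k : meet_closed F -> k \in F -> ev chi k ->
  exists m : nonzero L,
    [/\ val m \in F, ev chi (val m) & agree F (principal m) chi].
Proof.
move=> Fcl kF ck.
suff [m [mF cm mle]] : exists m, [/\ m \in F, ev chi m &
    forall k, k \in F -> ev chi k -> (m <= k)%O].
  exists (exist _ m (hat_nonzero cm)); split=> // l lF; rewrite ev_principal /=.
  by apply/idP/idP => [|ml]; [exact: mle|exact: character_le cm].
suff h s : exists m, [/\ m \in F, ev chi m &
    forall k, k \in s -> k \in F -> ev chi k -> (m <= k)%O].
  by have [m [mF cm h']] := h F; exists m; split=> // l lF; exact: h'.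
elim: s => [|l s [m [mF cm mle]]]; first by exists k.
have [/andP[lF cl]|nl] := boolP ((l \in F) && ev chi l); last first.
  exists m; split=> // l'; rewrite inE => /orP[/eqP->|]; last exact: mle.
  by move=> lF cl; move: nl; rewrite lF cl.
have [_ _ /(_ l m)[[//|n lmn cn] _]] := set_valP chi.
have [nl nm _] := lmn; exists n; split=> //; first exact: Fcl lmn.
move=> l'; rewrite inE => /orP[/eqP->//|l's l'F cl'].
by apply: le_trans nm _; exact: mle.
Qed.

(** The function w is an integral combination of the indicator functions of the
sets of characters equal to 1 at m, for nonzero m <= l. *)
Definition hat_combination (l : L) (w : hat L -> int) :=
  exists2 c : seq (int * nonzero L), (forall p, p \in c -> (val p.2 <= l)%O) &
    forall chi, w chi = \sum_(p <- c) p.1 * (ev chi (val p.2))%:R.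

(** Moebius inversion.  The function w is determined by its values at principal
characters of elements of F below l; subtracting w (principal x) times the
indicator function of [hat_at] x, for x maximal in a down-set A outside which
these values vanish, only changes the values at elements below x, all in A; and
the value at x becomes 0, so that A can be replaced by A without x. *)
Lemma agree_combination F l (w : hat L -> int) : meet_closed F -> l \in F ->
  (forall chi psi, agree F chi psi -> w chi = w psi) ->
  (forall chi, w chi != 0 -> ev chi l) -> hat_combination l w.
Proof.
move=> Fcl lF; set T := fun m : nonzero L => (val m \in F) && (val m <= l)%O.
suff h (A : seq (nonzero L)) : (forall m : nonzero L, m \in A -> T m) ->
    (forall m k : nonzero L, m \in A -> T k -> (val k <= val m)%O -> k \in A) ->
    (forall chi psi, agree F chi psi -> w chi = w psi) ->
    (forall chi, w chi != 0 -> ev chi l) ->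
    (forall m : nonzero L, T m -> m \notin A -> w (principal m) = 0) ->
    hat_combination l w.
  move=> wF wl.
  apply: (h [seq m : nonzero L <- pmap insub F | T m]) => //.
  - by move=> m; rewrite mem_filter => /andP[].
  - by move=> m k _ kT _; rewrite mem_filter kT mem_pmap_sub; case/andP: kT.
  - by move=> m mT; rewrite mem_filter mT mem_pmap_sub; case/andP: mT => ->.
have [n An] := ubnP (size A); elim: n A w An => // n IH A w; rewrite ltnS => An.
move=> AT Acl wF wl wA; have [A0|[x0 Ax0]] : A = [::] \/ exists x0, x0 \in A.
    by case: (A) => [|x0 s]; [left|right; exists x0; rewrite mem_head].
  exists [::] => // chi; rewrite big_nil; apply/eqP; apply: contraT => wc.
  have [m [mF cm /wF e]] := agree_principal Fcl lF (wl _ wc).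
  suff wm : w (principal m) = 0 by move: wc; rewrite -e wm eqxx.
  apply: wA; last by rewrite A0.
  rewrite /T mF /=; have : ev (principal m) l by apply: wl; rewrite e.
  by rewrite ev_principal.
have [x Ax xmax] := seq_max (fun m : nonzero L => val m) Ax0.
have /andP[xF xl] := AT _ Ax.
pose w' psi := w psi - w (principal x) * (ev psi (val x))%:R.
have [||||||c cl cE] := IH [seq y <- A | y != x] w'.
- apply: leq_trans An.
  rewrite size_filter -(count_predC (pred1 x)) -addn1 addnC.
  by rewrite leq_add2r -has_count has_pred1.
- by move=> m; rewrite mem_filter => /andP[_ /AT].
- move=> m k; rewrite !mem_filter => /andP[mx Am] Tk km.
  rewrite (Acl _ _ Am Tk km) andbT; apply: contraNneq mx => kx.
  have xm : (val x <= val m)%O by move: km; rewrite kx.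
  by have := xmax _ Am; rewrite lt_neqAle xm andbT => /negbFE/eqP/val_inj ->.
- by move=> chi psi e; rewrite /w' (wF _ _ e) e.
- move=> chi; rewrite /w'; apply: contra_neqT => nl.
  have -> : w chi = 0 by apply/eqP; apply: contraNT nl => /wl.
  case cx : (ev chi (val x)); last by rewrite mulr0 subr0.
  by move: nl; rewrite (character_le xl cx).
- move=> m Tm; rewrite mem_filter negb_and negbK /w' ev_principal.
  have [->|mx /= Am] := eqVneq m x; first by rewrite lexx mulr1 subrr.
  rewrite wA// sub0r; case mlx : (_ <= _)%O; last by rewrite mulr0 oppr0.
  by move: Am; rewrite (Acl _ _ Ax Tm mlx).
exists ((w (principal x), x) :: c) => [p|chi].
  by rewrite inE => /orP[/eqP->//|/cl].
by rewrite big_cons -cE /w' addrC subrK.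
Qed.

Lemma locally_finite_closure (hL : locally_finite L) s : exists F,
  meet_closed F /\ {subset s <= F}.
Proof.
have [_ [/finite_seqP[F ->] sF Fcl]] := hL [set` s] (finite_seq s).
by exists F; split=> [k l m kF lF|k ks]; [exact: Fcl|exact: sF].
Qed.

(** Covering W by finitely many basic neighbourhoods contained in W shows that
membership in W only depends on the values on a finite set. *)
Lemma hat_at_combination (hL : locally_finite L) l (W : set (hat L)) :
  compact W -> open W -> W `<=` hat_at l -> hat_combination l \1_W.
Proof.
move=> cW oW Wl.
have /boolp.choice[b bE] : forall chi, exists s,
    W chi -> forall psi, agree s chi psi -> W psi.
  move=> chi; have [Wc|nW] := pselect (W chi); last by exists [::].
  by have [s _ sW] := hat_basis oW Wc; exists s.
have [|t [tW Wt]] :=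
    @compact_finite_cover _ _ (fun chi => agree (b chi) chi) cW.
  by move=> chi _; exact: near_agree.
have [F [Fcl sF]] := locally_finite_closure hL (l :: flatten (map b t)).
have lF : l \in F by apply: sF; rewrite inE eqxx.
have FW chi psi : agree F chi psi -> W chi -> W psi.
  move=> e Wc; have [phi pt h] := Wt _ Wc; apply: (bE phi (tW _ pt)) => k kb.
  rewrite e ?h//; apply: sF; rewrite inE; apply/orP; right.
  by apply/flattenP; exists (b phi) => //; exact: map_f.
apply: (agree_combination Fcl lF) => [chi psi e|chi].
  rewrite !indicE; congr (nat_of_bool _)%:R.
  apply/idP/idP; rewrite !inE; apply: FW => //.
  by move=> k kF; rewrite e.
rewrite indicE; have [|_] := boolP (chi \in W); last by rewrite eqxx.
by rewrite inE => /Wl.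
Qed.

End HatTopology.

(** * The discretisation correspondence on nerves *)

Lemma discrete_ample (X : choiceType) : ample (discrete_topology X).
Proof.
move=> x O oO Ox; exists [set x]; split=> //; last by move=> _ ->.
split; [exact: compact_set1|exact: discrete_open|].
by apply/hausdorff_setP => _ _ -> ->.
Qed.

Lemma pushforward_indic (Y Z : topologicalType) (p : Y -> Z) (U : set Y)
    (V : set Z) (cU : compact_open_hausdorff U) (cV : compact_open_hausdorff V) :
  ample Y -> etale p -> set_inj U p -> p @` U = V ->
  cohz_pushforward p (cohz_indic cU) = cohz_indic cV.
Proof.
move=> aY ep iU pU; apply: val_inj.
by rewrite pushforwardE//= (fibre_sum_indic iU).2 pU.
Qed.

Section Discretisation.
Context {S : invSemigroupType} {d : Order.disp_t} {L : weakSemilatticeType d}.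
Variable a : order_action S L.

Local Notation G := (transformation_groupoid (nz_action a)).
Local Notation K := (transformation_groupoid (Omega0_action a)).
Local Notation H := (transformation_groupoid (hat_action a)).
Local Notation nrho n := (@nerve_map _ _ (germ_hom (rho a)) n).
Local Notation nsigma n := (@nerve_map _ _ (germ_hom (sigma a)) n).

Lemma Omega0_ext (z w : @Omega0 d L) :
  rho_fun z = rho_fun w -> sigma_fun z = sigma_fun w -> z = w.
Proof.
move=> e1 e2; apply: val_inj; move: e1 e2; rewrite /rho_fun /sigma_fun.
by case: z w => -[? ?] ? [[? ?] ?] /= -> ->.
Qed.

Lemma Omega0_mk (l : nonzero_space L) (chi : hat L) : ev chi (val l) ->
  exists z : @Omega0 d L, rho_fun z = l /\ sigma_fun z = chi.
Proof. by move=> cl; exists (exist _ (l, chi) (mem_set cl)). Qed.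

(** Omega0 is a disjoint union of open subsets of the character space, indexed
by the values of [rho_fun]. *)
Lemma sigma_etale : etale (sigma a).
Proof.
have cs : continuous (sigma a) by exact: sigma_continuous.
split=> [//||z].
- move=> O oO; rewrite openE => _ [z Oz <-].
  have [W oW WV] : open O by [].
  have hcvg : (fun psi => (rho_fun z, psi)) @ sigma_fun z -->
      (rho_fun z, sigma_fun z).
    apply: (@cvg_pair _ _ _ (nbhs (sigma_fun z)) (nbhs (rho_fun z))
      (nbhs (sigma_fun z))); first exact: cvg_cst.
    exact: cvg_id.
  have : nbhs (rho_fun z, sigma_fun z) W.
    apply: open_nbhs_nbhs; split=> //; move: Oz; rewrite -WV.
    by rewrite /preimage/= /rho_fun /sigma_fun -surjective_pairing.
  move=> /hcvg hW.
  have {}hW : \forall psi \near sigma_fun z, W (rho_fun z, psi) by exact: hW.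
  apply: filterS2 (near_eval (sigma_fun z) (val (rho_fun z))) hW => psi e Wpsi.
  have zpsi : ev psi (val (rho_fun z)) by rewrite e; exact: ev_Omega0.
  by exists (exist _ (rho_fun z, psi) (mem_set zpsi)) => //; rewrite -WV.
- exists (rho_fun @^-1` [set rho_fun z]); split=> //.
    by apply: open_comp => [? _|]; [exact: rho_continuous|exact: discrete_open].
  by move=> v w; rewrite !inE => vE wE; apply: Omega0_ext; rewrite vE wE.
Qed.

Lemma nz_ample : ample (nonzero_space L).
Proof. exact: discrete_ample. Qed.

Lemma Omega0_ample : ample (@Omega0 d L).
Proof. exact: etale_ample sigma_etale hat_ample. Qed.

Lemma nerve_G_ample n : ample (nerve G n).
Proof. exact: etale_ample (@base_etale _ _ _ n) nz_ample. Qed.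

Lemma nerve_K_ample n : ample (nerve K n).
Proof. exact: etale_ample (@base_etale _ _ _ n) Omega0_ample. Qed.

Lemma nerve_H_ample n : ample (nerve H n).
Proof. exact: etale_ample (@base_etale _ _ _ n) hat_ample. Qed.

Lemma nsigma_etale n : etale (nsigma n).
Proof. exact/nerve_map_etale/sigma_etale. Qed.

Lemma nrho_continuous n : continuous (nrho n).
Proof. exact/nerve_map_continuous/rho_continuous. Qed.

(** * Unique lifting along rho *)

(** The domain of s in Omega0 is the full preimage of its domain in L^x; hence
an equality of germs downstairs lifts. *)
Lemma germ_at_lift s (k : garr K) :
  germ_at s (germ_map (rho a) k) -> germ_at s k.
Proof.
elim/germW: k => t z tz; have trz := emap_dom (rho a) tz.
rewrite (germ_mapE _ trz) => -[sx]; rewrite germ_srcE in sx * => /germ_eqP.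
move=> [_ [u [ut us ux]]].
have sz : pdom (Omega0_action a) s z by exact: sx.
suff -> : germ tz = germ sz by exact: germ_at_germ.
by apply/germ_eqP; split=> //; exists u.
Qed.

Lemma germ_lift_uniq (k k' : garr K) :
  germ_map (rho a) k = germ_map (rho a) k' ->
  germ_src k = germ_src k' -> k = k'.
Proof.
move=> e; have sk := germ_at_repr k.
apply: (germ_at_inj sk); apply: germ_at_lift; rewrite -e.
exact: (germ_at_map (rho a) sk).
Qed.

Lemma germ_lift_rng_uniq (k k' : garr K) :
  germ_map (rho a) k = germ_map (rho a) k' ->
  germ_rng k = germ_rng k' -> germ_src k = germ_src k'.
Proof.
move=> e; have sk := germ_at_repr k; set s := (val (repr k)).1 in sk.
have sk' : germ_at s k'.
  by apply: germ_at_lift; rewrite -e; exact: (germ_at_map (rho a) sk).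
rewrite (germ_at_rng sk) (germ_at_rng sk').
by apply: papp_inj; exact: germ_at_dom.
Qed.

Lemma seq_dom_lift s z : seq_dom (nz_action a) s (rho_fun z) ->
  seq_dom (Omega0_action a) s z.
Proof.
elim: s => //= t s IH [/IH sz tz]; split=> //.
have [_ e] := seq_dom_map (rho a) sz.
by move: tz; rewrite -[rho_fun z]/(rho a z) e.
Qed.

Lemma lift_uniq n (k k' : nerve K n) :
  nrho n k = nrho n k' -> base k = base k' -> k = k'.
Proof.
case: n k k' => [//|n] k k' e b; apply: nerve_eq => // j.
apply: germ_lift_uniq.
exact: (congr1 (fun h : nerve G n.+1 => val h j) e).
Qed.

(** Unlike for [sigma], a sequence that can be applied to rho z can be applied
to z. *)
Lemma lift_represents n s (g : nerve G n) z : size s = n ->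
  represents s (base g) g -> rho_fun z = base g ->
  exists k : nerve K n, represents s z k /\ nrho n k = g.
Proof.
move=> sn gs zg; have := represents_dom sn gs; rewrite -zg => /seq_dom_lift sz.
have [k ks] := represents_exists sn sz; exists k; split=> //.
apply: represents_uniq (represents_map (rho a) sn ks) _.
by rewrite -[emap _ _]/(rho_fun z) zg.
Qed.

Lemma lift_exists n (g : nerve G n) z : rho_fun z = base g ->
  exists k : nerve K n, nrho n k = g /\ base k = z.
Proof.
move=> zg; have [s sn gs] := nerve_represents g.
have [k [ks kg]] := lift_represents sn gs zg.
by exists k; split=> //; exact: represents_base ks.
Qed.

Lemma represents_lift n s (k : nerve K n) : size s = n ->
  represents s (base (nrho n k)) (nrho n k) -> represents s (base k) k.
Proof.
move=> sn gs; have [|k' [ks' e]] := lift_represents (z := base k) sn gs.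
  by rewrite base_map.
suff -> : k = k' by rewrite (represents_base sn ks').
by apply: lift_uniq; rewrite ?e// (represents_base sn ks').
Qed.

Lemma face_lift_uniq n (i : 'I_n.+2) (k k' : nerve K n.+1) :
  nrho n.+1 k = nrho n.+1 k' -> face i k = face i k' -> k = k'.
Proof.
move=> e ef; apply: lift_uniq => //; have := congr1 (@base K n) ef.
have [ilt|ni] := ltnP i n.+1; first by rewrite !base_face.
have -> : i = ord_max.
  by apply: val_inj; apply/eqP; rewrite eqn_leq ni -ltnS ltn_ord.
rewrite !base_face_max; apply: germ_lift_rng_uniq.
exact: (congr1 (fun h : nerve G n.+1 => val h ord_max) e).
Qed.

(** For the last face the base point of the lift is not that of k: it is found
by moving the base point of k back along the last arrow of g. *)
Lemma face_lift_exists n (i : 'I_n.+2) (g : nerve G n.+1) (k : nerve K n) :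
  nrho n k = face i g -> exists k', nrho n.+1 k' = g /\ face i k' = k.
Proof.
move=> kg; have rb : rho_fun (base k) = base (face i g) by rewrite -kg base_map.
suff [z [zg zk]] : exists z, rho_fun z = base g /\
    forall k' : nerve K n.+1, nrho n.+1 k' = g -> base k' = z ->
      base (face i k') = base k.
  have [k' [k'g bk]] := lift_exists zg; exists k'; split=> //.
  by apply: lift_uniq; [rewrite -face_map k'g|exact: zk].
have [ilt|ni] := ltnP i n.+1.
  by exists (base k); rewrite rb base_face//; split=> // k' _; rewrite base_face.
have iE : i = ord_max.
  by apply: val_inj; apply/eqP; rewrite eqn_leq ni -ltnS ltn_ord.
move: rb; rewrite iE base_face_max /last_rng.
have sg := germ_at_repr (val g ord_max : germ_space (nz_action a)).
set s := (val (repr _)).1 in sg; rewrite (germ_at_rng sg) => rb.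
have sl := germ_at_dom sg.
have sw : pdom (Omega0_action a) (sinv s) (base k).
  change (pdom (nz_action a) (sinv s) (rho_fun (base k))).
  by rewrite rb; exact: pdom_sinv.
exists (papp (Omega0_action a) (sinv s) (base k)); split.
  by rewrite -[LHS]/(rho a _) emap_app// [emap _ _]rb pappK.
move=> k' k'g bk'; rewrite base_face_max /last_rng.
have sk : germ_at s (val k' ord_max : germ_space (Omega0_action a)).
  apply: germ_at_lift; move: sg; rewrite -k'g; exact.
by rewrite (germ_at_rng sk) -[germ_src _]/(base k') bk' pappVK.
Qed.

(** * Cells and the chain map *)

Definition fibre n (g : nerve G n) : set (nerve K n) := nrho n @^-1` [set g].

Definition cell n (g : nerve G n) : set (nerve H n) := nsigma n @` fibre g.

Lemma coh_set1 n (g : nerve G n) : compact_open_hausdorff [set g].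
Proof.
split; [exact: compact_set1| |by apply/hausdorff_setP => _ _ -> ->].
have [cb _ ib] := base_etale (nz_action a) n; have [V [oV Vg iV]] := ib g.
have -> : [set g] = V `&` @base G n @^-1` [set base g].
  apply/seteqP; split=> [_ -> //|h [Vh hg]].
  by apply: iV; rewrite ?inE.
apply: openI => //; apply: open_comp => [h _|]; first exact: cb.
exact: discrete_open.
Qed.

Lemma open_fibre n (g : nerve G n) : open (fibre g).
Proof.
apply: open_comp => [k _|]; first exact: nrho_continuous.
by have [] := coh_set1 g.
Qed.

Lemma rho_base_fibre n (g : nerve G n) k : fibre g k -> rho_fun (base k) = base g.
Proof. by move=> <-; rewrite base_map. Qed.

(** A point of Omega0 consists of an element of L and a character, and the
former is prescribed on the fibre of g. *)
Lemma fibre_inj n (g : nerve G n) : set_inj (fibre g) (sigma a \o @base K n).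
Proof.
move=> k k'; rewrite !inE => gk gk' e; apply: lift_uniq; first by rewrite gk gk'.
by apply: Omega0_ext => //; rewrite !(rho_base_fibre (g := g)).
Qed.

Lemma fibre_image n (g : nerve G n) :
  (sigma a \o @base K n) @` fibre g = hat_at (val (base g : nonzero_space L)).
Proof.
apply/seteqP; split=> [_ [k gk <-]|chi cg].
  by rewrite /hat_at /= -(rho_base_fibre gk); exact: ev_Omega0.
have [z [zg zc]] := Omega0_mk cg; have [k [kg kz]] := lift_exists zg.
by exists k => //=; rewrite kz.
Qed.

Lemma coh_fibre n (g : nerve G n) : compact_open_hausdorff (fibre g).
Proof.
apply: coh_preimage (@fibre_inj _ g) _.
- by apply: etale_comp sigma_etale; exact: base_etale.
- exact: open_fibre.
- by rewrite fibre_image; exact: coh_hat_at.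
Qed.

Lemma nsigma_inj n (g : nerve G n) : set_inj (fibre g) (nsigma n).
Proof.
move=> k k' gk gk' e; apply: (fibre_inj gk gk').
by have := congr1 (@base H n) e; rewrite !base_map.
Qed.

(** The fibre of g is homeomorphic to [hat_at] of its base point, by [fibre_inj]
and [fibre_image], and to the cell of g by [nsigma_inj]. *)
Lemma coh_cell n (g : nerve G n) : compact_open_hausdorff (cell g).
Proof.
apply: coh_image; [exact: nsigma_etale|exact: nsigma_inj|exact: coh_fibre].
Qed.

Lemma base_cell n (g : nerve G n) :
  @base H n @` cell g = hat_at (val (base g : nonzero_space L)).
Proof.
rewrite -fibre_image /cell image_comp; congr (_ @` _); apply/funext => k.
exact: base_map.
Qed.

Lemma base_cell_inj n (g : nerve G n) : set_inj (cell g) (@base H n).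
Proof.
move=> _ _ /set_mem[k gk <-] /set_mem[k' gk' <-]; rewrite !base_map => e.
by congr (nsigma n _); apply: (fibre_inj (mem_set gk) (mem_set gk')).
Qed.

(** Both parts come from unique lifting of faces along [rho]. *)
Lemma face_cell n (i : 'I_n.+2) (g : nerve G n.+1) :
  set_inj (cell g) (face i) /\ face i @` cell g = cell (face i g).
Proof.
split.
  move=> _ _ /set_mem[k gk <-] /set_mem[k' gk' <-]; rewrite !face_map => e.
  congr (nsigma n.+1 _); apply: (@face_lift_uniq _ i); first by rewrite gk gk'.
  by apply: (@nsigma_inj _ (face i g)) e; apply/mem_set;
    rewrite /fibre /preimage /= -face_map; [rewrite gk|rewrite gk'].
apply/seteqP; split=> [_ [_ [k gk <-] <-]|_ [k gk <-]].
  exists (face i k); last by rewrite face_map.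
  by rewrite /fibre /preimage /= -face_map gk.
have [k' [gk' kk]] := face_lift_exists gk.
by exists (nsigma n.+1 k'); [exists k'|rewrite face_map kk].
Qed.

Definition delta n (g : nerve G n) : chains G n := cohz_indic (coh_set1 g).

Lemma chains_ind n (P : chains G n -> Prop) : P 0 ->
  (forall f g, P f -> P g -> P (f - g)) -> (forall g, P (delta g)) ->
  forall f, P f.
Proof.
move=> P0 PB Pd f.
suff [f' [ff' Pf']] : exists f' : chains G n, val f' = val f /\ P f'.
  by have <- : f' = f by exact: val_inj.
move: (val f) (valP f); apply: (@cohfun_ind _
  (fun f => exists f' : chains G n, val f' = f /\ P f')
  [set V | exists g : nerve G n, V = [set g]]).
- exact: nerve_G_ample.
- by move=> g; exists [set g]; [exists g|split=> //; have [] := coh_set1 g].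
- by exists 0; split.
- move=> _ _ [f' [<- Pf]] [g' [<- Pg]]; exists (f' - g'); split; last exact: PB.
  by rewrite raddfB.
move=> U V _ [g ->] Ug; have [gU|gU] := pselect (U g).
  exists (delta g); split=> //=; congr (\1_ _).
  by apply/seteqP; split=> [_ ->//|].
exists 0; split=> //; have -> : U = set0; last by rewrite indic0.
by apply/seteqP; split=> // h Uh; apply: gU; rewrite -(Ug _ Uh).
Qed.

Lemma pullbackE n (f : chains G n) :
  val (cohz_pullback (nrho n) f) = val f \o nrho n.
Proof.
apply: (@cohz_mapE _ _ (fun f : nerve G n -> int => f \o nrho n)) => //.
move=> {}f fc; pose f' : chains G n := Sub f fc.
have -> : f = val f' by rewrite SubK.
apply: (@chains_ind _ (fun f => val f \o nrho n \in @cohfun (nerve K n))).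
- exact: rpred0.
- move=> f1 f2 h1 h2; have -> : val (f1 - f2) = val f1 - val f2 by rewrite raddfB.
  exact: rpredB h1 h2.
- by move=> g; exact: cohfun_indic (coh_fibre g).
Qed.

Lemma discretisationE n (f : chains G n) :
  val (discretisation_chain a n f) = fibre_sum (nsigma n) (val f \o nrho n).
Proof.
rewrite /discretisation_chain pushforwardE ?pullbackE//.
  exact: nerve_K_ample.
exact: nsigma_etale.
Qed.

Lemma discretisation_delta n (g : nerve G n) :
  discretisation_chain a n (delta g) = cohz_indic (coh_cell g).
Proof.
apply: val_inj; rewrite discretisationE.
rewrite (_ : _ \o _ = \1_(fibre g)); last by apply/funext.
by rewrite (fibre_sum_indic (@nsigma_inj _ g)).2.
Qed.

Lemma discretisationB n : zmod_morphism (discretisation_chain a n).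
Proof. by move=> f g; rewrite /discretisation_chain !raddfB. Qed.

HB.instance Definition _ n := GRing.isZmodMorphism.Build (chains G n) (chains H n)
  (discretisation_chain a n) (@discretisationB n).

Lemma discretisation_boundary n (f : chains G n.+1) :
  boundary (discretisation_chain a n.+1 f) = discretisation_chain a n (boundary f).
Proof.
move: f; apply: chains_ind; first by rewrite !raddf0.
  by move=> f g ef eg; rewrite !raddfB/= ef eg.
move=> g; rewrite discretisation_delta /boundary raddf_sum.
apply: eq_bigr => i _.
rewrite raddfMz; congr (_ *~ _).
have [fi fE] := face_cell i g.
have -> : cohz_pushforward (face i) (delta g) = delta (face i g).
  apply: pushforward_indic; [exact: nerve_G_ample|exact: face_etale| |].
    by move=> ? ? /set_mem-> /set_mem->.
  by rewrite image_set1.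
apply: etrans (esym (discretisation_delta _)); apply: pushforward_indic => //.
  exact: nerve_H_ample.
exact: face_etale.
Qed.

(** * Injectivity and surjectivity *)

Lemma principal_dom s (l : nonzero_space L) :
  nz_dom a s l -> hat_dom a s (principal l).
Proof. by move=> sl; exists (val l) => //; rewrite ev_principal. Qed.

Lemma principal_app s (l : nonzero_space L) : nz_dom a s l ->
  principal (nz_app a s l) = hat_app a s (principal l).
Proof.
move=> sl; apply: hat_ext => k; rewrite hat_appE; last exact: principal_dom.
rewrite ev_principal [val _]nz_appE//; apply/idP/idP => [lk|/hat_funP].
  by apply/hat_funP; exists (val l); split=> //; rewrite ev_principal.
move=> [m [sm mk lm]]; apply: le_trans mk; rewrite papp_mono//.
Qed.

Definition principal_map : equivariant (nz_action a) (hat_action a) :=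
  @Equivariant _ _ _ (nz_action a) (hat_action a) (@principal d L)
    principal_dom principal_app.

Local Notation niota n := (@nerve_map _ _ (germ_hom principal_map) n).

(** A principal character is 1 at an element of L only if its generator lies
below it. *)
Lemma iota_cell_le n (g : nerve G n) (k : nerve K n) : nsigma n k = niota n g ->
  (val (base g : nonzero_space L) <= val (base (nrho n k) : nonzero_space L))%O.
Proof.
move=> /(congr1 (@base H n)); rewrite !base_map => e.
have := ev_Omega0 (base k).
by rewrite -[sigma_fun _]/(sigma a _) e ev_principal.
Qed.

(** Germs at a principal character are germs at its generator: an element of S
defined at some m above l is defined at l, as domains are down-sets. *)
Lemma iota_cell_eq n (g : nerve G n) (k : nerve K n) : nsigma n k = niota n g ->
  base g = base (nrho n k) -> nrho n k = g.
Proof.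
case: n g k => [//|n] g k e b; apply/esym/nerve_eq => // j.
have := congr1 (fun h : nerve H n.+1 => val h j : germ_space (hat_action a)) e.
rewrite /= {e b}.
move: (val g j : germ_space (nz_action a))
  (val k j : germ_space (Omega0_action a)).
move=> {}g {}k; elim/germW: g => s l sl; elim/germW: k => t z tz.
have trz := emap_dom (rho a) tz; have tsz := emap_dom (sigma a) tz.
have spl := emap_dom principal_map sl.
rewrite (germ_mapE _ trz) (germ_mapE _ tsz) (germ_mapE _ spl) !germ_srcE.
move=> e; have [zl [u [ut us [m um cm]]]] := (germ_eqP tsz spl).1 e => lz.
apply: (germ_eqP sl trz).2; split=> //; exists u; split=> //.
by apply: (pdom_down um); move: cm; rewrite [emap _ _]zl ev_principal.
Qed.

(** The companion of g and the lift of g with base (l, principal l), for l the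
base point of g, are represented by the same sequence. *)
Lemma lift_cell n (g : nerve G n) :
  exists2 k, nrho n k = g & nsigma n k = niota n g.
Proof.
have [z [zg zp]] : exists z : @Omega0 d L, rho_fun z = base g /\
    sigma_fun z = principal (base g).
  by apply: Omega0_mk; rewrite ev_principal.
have [s sn gs] := nerve_represents g.
have [k [ks kg]] := lift_represents sn gs zg; exists k => //.
apply: represents_uniq (represents_map (sigma a) sn ks) _.
by rewrite [emap _ _]zp; exact: (represents_map principal_map sn gs).
Qed.

Lemma chains_finite_support n (f : chains G n) :
  finite_set [set g | val f g != 0].
Proof.
move: f; apply: chains_ind.
- by apply: (@sub_finite_set _ _ set0) => // g /=; rewrite eqxx.
- move=> f g ff fg; apply: (@sub_finite_set _ _
    ([set h | val f h != 0] `|` [set h | val g h != 0])); last first.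
    by rewrite finite_setU.
  move=> h /= fgh; have p : (val f - val g) h != 0 by rewrite -raddfB.
  have [fh|] := eqVneq (val f h) 0; [right|by left].
  apply: contra_neq p => gh.
  by rewrite -[LHS]/(val f h - val g h) fh [val g h]gh subr0.
- move=> g; apply: sub_finite_set (finite_set1 g) => h /=; rewrite indicE.
  by have [|_] := boolP (h \in [set g]); rewrite ?inE ?eqxx.
Qed.

(** The value of the image of f at the companion of g is the sum of the values
of f at the g' whose cells contain it; all these g' have base points above that
of g, and g itself is the only one in the support of f when g is maximal. *)
Lemma discretisation_inj n : injective (discretisation_chain a n).
Proof.
apply: raddf_inj => f F0; apply/eqP; apply: contraT => f0.
have /finite_seqP[s sE] := chains_finite_support f.
have fs g : g \in s -> val f g != 0.
  by move=> gs; have : [set g | val f g != 0] g by rewrite sE.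
have sf g : val f g != 0 -> g \in s.
  by move=> gs; have : [set` s] g by rewrite -sE.
have [g0 g0s] : exists g0, g0 \in s.
  apply: contrapT => /forallNP ns; move/negP: f0; apply; apply/eqP/val_inj.
  by apply/funext => g; apply/eqP; apply: contraT => /sf /ns.
have [g gs gmax] := seq_max (fun g : nerve G n => val (base g : nonzero L)) g0s.
have := congr1 (fun w : chains H n => val w (niota n g)) F0.
rewrite discretisationE raddf0 => F0g.
suff e : val f g = 0 by have := fs _ gs; rewrite e eqxx.
apply: etrans _ F0g; have [k kg ks] := lift_cell g.
rewrite (@fibre_sumE _ _ _ _ _ [set k]).
- by rewrite fsbig_set1 /= kg.
- move=> k' [/= k's /sf k'S].
  have kle := iota_cell_le k's; have := gmax _ k'S.
  rewrite lt_neqAle kle andbT => /negbFE/eqP/val_inj b.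
  have e := iota_cell_eq k's b.
  by apply: (@nsigma_inj n g); rewrite ?inE//= k's ks.
- by move=> _ ->.
Qed.

(** Applying t to a character chi moves the elements at which chi is 1; so the
element needed for the next step is pulled back to one that is defined for all
previous steps. *)
Lemma seq_dom_hat s (chi : hat L) k : seq_dom (hat_action a) s chi ->
  ev (foldr (papp (hat_action a)) chi s) k -> exists z : @Omega0 d L,
  [/\ sigma_fun z = chi, seq_dom (Omega0_action a) s z &
    (val (rho_fun (foldr (papp (Omega0_action a)) z s)) <= k)%O].
Proof.
elim: s k => [k _ ck|t s IH k [sc tc]].
  have [z [zk zc]] := @Omega0_mk (exist _ k (hat_nonzero ck)) chi ck.
  by exists z; split=> //=; rewrite zk.
rewrite -[foldr _ _ _]/(hat_app a t (foldr (papp (hat_action a)) chi s)).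
rewrite hat_appE// => /hat_funP[k' [tk' k'k ck']].
have [z [zc sz zk']] := IH _ sc ck'.
have tz : pdom (Omega0_action a) t (foldr (papp (Omega0_action a)) z s).
  exact: (pdom_down tk' zk').
exists z; split=> //=; rewrite rho_app// nz_appE//.
by apply: le_trans k'k; rewrite papp_mono.
Qed.

Lemma nsigma_surj n (h : nerve H n) : exists k, nsigma n k = h.
Proof.
have [s sn hs] := nerve_represents h; have sc := represents_dom sn hs.
have [z [zh sz]] : exists z : @Omega0 d L, sigma_fun z = base h /\
    seq_dom (Omega0_action a) s z.
  have [[k ck] _ _] := set_valP (foldr (papp (hat_action a)) (base h) s).
  by have [z [zh sz _]] := seq_dom_hat sc ck; exists z.
have [k ks] := represents_exists sn sz; exists k.
apply: represents_uniq (represents_map (sigma a) sn ks) _.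
by rewrite [emap _ _]zh.
Qed.

Lemma seq_dom_le s (l m : nonzero_space L) : seq_dom (nz_action a) s l ->
  (val m <= val l)%O -> seq_dom (nz_action a) s m /\
  (val (foldr (papp (nz_action a)) m s) <=
   val (foldr (papp (nz_action a)) l s))%O.
Proof.
elim: s => //= t s IH [sl tl] ml; have [sm sml] := IH sl ml.
have tm : nz_dom a t (foldr (papp (nz_action a)) m s).
  exact: (pdom_down tl sml).
split=> //; rewrite [X in (X <= _)%O](nz_appE tm) [X in (_ <= X)%O](nz_appE tl).
by rewrite papp_mono.
Qed.

(** The tuple g' is g with its base point decreased to m, which is possible as
domains are down-sets. *)
Lemma restrict_cell n (g : nerve G n) (m : nonzero_space L) :
  (val m <= val (base g : nonzero_space L))%O -> exists g' : nerve G n,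
  cell g' = cell g `&` @base H n @^-1` hat_at (val m).
Proof.
move=> ml; have [s sn gs] := nerve_represents g.
have [sm _] := seq_dom_le (represents_dom sn gs) ml.
have [g' gs'] := represents_exists sn sm; exists g'.
have bg' := represents_base sn gs'.
(* The fibres of both tuples consist of tuples represented by s, and the image
   in the nerve of H only remembers s and the character at the base. *)
have move_cell (g1 g2 : nerve G n) k : represents s (base g1) g1 ->
    represents s (base g2) g2 -> fibre g1 k ->
    ev (sigma_fun (base k)) (val (base g2 : nonzero_space L)) ->
    cell g2 (nsigma n k).
  move=> s1 s2 k1 c2; have [z [z2 zk]] := Omega0_mk c2.
  have [k' [ks' k2]] := lift_represents sn s2 z2.
  exists k' => //; have ks : represents s (base k) k.
    by apply: represents_lift => //; rewrite k1.
  apply: represents_uniq (represents_map (sigma a) sn ks') _.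
  rewrite [emap _ _]zk; exact: (represents_map (sigma a) sn ks).
have gs2 : represents s (base g') g' by rewrite bg'.
apply/seteqP; split=> [_ [k gk <-]|_ [[k gk <-] mk]].
  have ck : ev (sigma_fun (base k)) (val m).
    by rewrite -bg' -(rho_base_fibre gk); exact: ev_Omega0.
  split; last by rewrite /preimage /= base_map.
  by apply: (move_cell g' g) => //; exact: character_le ml ck.
apply: (move_cell g g') => //; rewrite bg'.
by move: mk; rewrite /preimage /= base_map.
Qed.

(** It is enough to reach the indicator function of a compact open subset V of
the cell of some g.  The source map identifies V with a compact open set W of
characters equal to 1 at the base point of g, and each term of a combination
for W is realised by the cell of a restriction of g. *)
Lemma discretisation_surj (hL : locally_finite L) n (w : chains H n) :
  exists f, discretisation_chain a n f = w.
Proof.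
suff [f fw] : exists f, val (discretisation_chain a n f) = val w.
  by exists f; exact: val_inj.
move: (val w) (valP w); apply: (@cohfun_ind _
  (fun w => exists f, val (discretisation_chain a n f) = w)
  [set V | exists g : nerve G n, V = cell g]).
- exact: nerve_H_ample.
- move=> h; have [k kh] := nsigma_surj h; exists (cell (nrho n k)).
    by exists (nrho n k).
  by split; [have [] := coh_cell (nrho n k)|exists k].
- by exists 0; rewrite !raddf0.
- by move=> _ _ [f <-] [g <-]; exists (f - g); rewrite !raddfB.
move=> V _ cV [g ->] Vg.
pose W := @base H n @` V.
have cW : compact_open_hausdorff W.
  apply: coh_image => //; first exact: base_etale.
  by move=> x y /set_mem Vx /set_mem Vy; apply: base_cell_inj; apply/mem_set/Vg.
have Wg : W `<=` hat_at (val (base g : nonzero_space L)).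
  by rewrite -base_cell; exact: image_subset.
have [c cl cE] : hat_combination (val (base g : nonzero_space L)) \1_W.
  by case: cW => *; exact: hat_at_combination.
have [f fE] : exists f, forall h, val (discretisation_chain a n f) h =
    \1_(cell g) h * \sum_(p <- c) p.1 * (ev (base h) (val p.2))%:R.
  elim: c cl {cE} => [_|p c IH cl].
    by exists 0 => h; rewrite !raddf0 big_nil mulr0.
  have [|f fE] := IH; first by move=> q qc; apply: cl; rewrite inE qc orbT.
  have [|g' g'E] := @restrict_cell n g p.2.
    by apply: cl; rewrite mem_head.
  exists (delta g' *~ p.1 + f) => h.
  have -> : discretisation_chain a n (delta g' *~ p.1 + f) =
      cohz_indic (coh_cell g') *~ p.1 + discretisation_chain a n f.
    by rewrite raddfD raddfMz; congr (_ *~ _ + _); exact: discretisation_delta.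
  rewrite raddfD raddfMz /= indic_mulrz big_cons mulrDr -fE; congr (_ + _).
  rewrite g'E !indicE in_setI -mulnb natrM mulrCA; congr (_ * (_ * _%:R)).
  by congr nat_of_bool; apply/idP/idP; rewrite inE.
exists f; apply/funext => h; rewrite fE -cE.
have [gh|ngh] := pselect (cell g h); last first.
  rewrite indicE memNset// mul0r indicE memNset// => /Vg //.
rewrite indicE mem_set// mul1r !indicE; congr (nat_of_bool _)%:R.
apply/idP/idP => /set_mem; last by move=> Vh; apply/mem_set; exists h.
move=> [h' Vh' e]; apply/mem_set; suff <- : h' = h by [].
by apply: (@base_cell_inj n g) e; rewrite inE//; exact: Vg.
Qed.

End Discretisation.

(** * Isomorphisms of chain complexes and homology *)

Section ChainIsomorphism.
Variables (G H : groupoid) (F : forall n, {additive chains G n -> chains H n}).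
Hypothesis F_boundary : forall n (f : chains G n.+1),
  boundary (F n.+1 f) = F n (boundary f).
Hypothesis F_inj : forall n, injective (F n).
Hypothesis F_surj : forall n w, exists f, F n f = w.

Lemma chain_is_cycle n (f : chains G n) :
  (F n f \in @is_cycle H n) = (f \in @is_cycle G n).
Proof.
case: n f => [//|n] f; rewrite /in_mem /= F_boundary.
by apply/eqP/eqP => [e|->]; [apply: (@F_inj n); rewrite e raddf0|rewrite raddf0].
Qed.

Definition cycle_map n (f : cycles G n) : cycles H n :=
  Sub (F n (val f)) (etrans (chain_is_cycle (val f)) (valP f)).

Lemma homology_class_eq (G' : groupoid) n (f g : cycles G' n) :
  homology_class f = homology_class g <-> exists h, val f - val g = boundary h.
Proof.
split=> [/eqP|[h e]].
  by rewrite -Quotient.idealrBE => /asboolP[h]; rewrite raddfB; exists h.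
by apply/eqP; rewrite -Quotient.idealrBE; apply/asboolP; exists h; rewrite raddfB.
Qed.

Lemma cycle_map_class n (f g : cycles G n) :
  homology_class (cycle_map f) = homology_class (cycle_map g) <->
  homology_class f = homology_class g.
Proof.
rewrite !homology_class_eq !SubK -raddfB; split=> [[h]|[h ->]].
  have [f' <-] := F_surj h; rewrite F_boundary => /F_inj e; by exists f'.
by exists (F n.+1 h); rewrite F_boundary.
Qed.

(** Defined on representatives; the choice is immaterial by [homology_mapE]. *)
Definition homology_map n (x : homology G n) : homology H n :=
  homology_class (cycle_map (repr x)).

Lemma homology_mapE n (f : cycles G n) :
  homology_map (homology_class f) = homology_class (cycle_map f).
Proof. by apply/cycle_map_class; exact: reprK. Qed.

Lemma homologyW (G' : groupoid) n (P : homology G' n -> Prop) :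
  (forall f, P (homology_class f)) -> forall x, P x.
Proof. by move=> h x; rewrite -[x]reprK; exact: h. Qed.

Lemma homology_classB (G' : groupoid) n (f g : cycles G' n) :
  homology_class (f - g) = homology_class f - homology_class g.
Proof. by rewrite /homology_class raddfB. Qed.

Lemma homology_map_zmod_morphism n : zmod_morphism (@homology_map n).
Proof.
elim/homologyW => f; elim/homologyW => g.
rewrite -homology_classB !homology_mapE -homology_classB; congr homology_class.
by apply: val_inj; rewrite -[LHS]/(F n (val f - val g)) [LHS]raddfB [RHS]raddfB.
Qed.

HB.instance Definition _ n := GRing.isZmodMorphism.Build _ _ (@homology_map n)
  (@homology_map_zmod_morphism n).

Lemma homology_map_bij n : bijective (@homology_map n).
Proof.
have inj : injective (@homology_map n).
  elim/homologyW => f; elim/homologyW => g.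
  by rewrite !homology_mapE => /cycle_map_class.
suff /boolp.choice[g gK] : forall y, exists x, @homology_map n x = y.
  by exists g => // x; exact: inj (gK _).
elim/homologyW => w; have [f fw] := F_surj (val w).
have cf : f \in @is_cycle G n by rewrite -chain_is_cycle fw; exact: valP.
exists (homology_class (Sub f cf)); rewrite homology_mapE; congr homology_class.
by apply: val_inj; rewrite !SubK.
Qed.

Lemma chain_isomorphism_homology : exists phi : forall n,
    {additive homology G n -> homology H n},
  forall n, induced_in_homology (F n) (phi n) /\ bijective (phi n).
Proof.
exists (fun n => @homology_map n : {additive _ -> _}) => n.
split; last exact: homology_map_bij.
by move=> f; exists (cycle_map f); [rewrite SubK|exact: homology_mapE].
Qed.

End ChainIsomorphism.

Theorem theorem4p10 (S : invSemigroupType) (d : Order.disp_t)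
    (L : weakSemilatticeType d) (hL : locally_finite L)
    (a : order_action S L) :
  exists phi : forall n : nat,
      {additive homology (transformation_groupoid (nz_action a)) n ->
                homology (transformation_groupoid (hat_action a)) n},
    forall n : nat,
      induced_in_homology (discretisation_chain a n) (phi n) /\
      bijective (phi n).
Proof.
apply: (@chain_isomorphism_homology _ _
  (fun n => discretisation_chain a n : {additive _ -> _})).
- move=> n f; exact: discretisation_boundary.
- move=> n; exact: discretisation_inj.
- move=> n w; exact: discretisation_surj.
Qed.
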